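(* Let $n,k\ge 0$ be integers. Then: 1. $H^\ell(\mathcal{C}(2n,2k))=\{0\}$ for every $\ell>0$. 2. $H^\ell(\mathcal{C}(2n+1,2k))\simeq H^\ell(\mathcal{C}(1,2k))$ (as vector spaces) for every $\ell\ge 0$.
   Context: All algebras are unital associative over $\mathbb{C}$. For $n,k\ge 0$ the Clifford--Weyl algebra $\mathcal{C}(n,2k)$ is the algebra with generators $\omega_1,\dots,\omega_n,p_1,q_1,\dots,p_k,q_k$ and relations $\omega_i\omega_j+\omega_j\omega_i=2\delta_{ij}$; $p_iq_j-q_jp_i=\delta_{ij}$, $p_ip_j=p_jp_i$, $q_iq_j=q_jq_i$; $\omega_ip_j+p_j\omega_i=0$, $\omega_iq_j+q_j\omega_i=0$ for all $i,j$. For an algebra $A$, $H^\ell(A)$ denotes the $\ell$-th Hochschild cohomology space of $A$ with coefficients in the bimodule $A$ itself. *)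

(* Defs.v *)
From HB Require Import structures.
From mathcomp Require Import all_boot all_order all_algebra.
From mathcomp Require Import boolp classical_sets functions.
From mathcomp Require Import finmap.
From mathcomp Require Import monalg zify.

Set Implicit Arguments.
Unset Strict Implicit.
Unset Printing Implicit Defensive.

Import GRing.Theory.

Local Open Scope ring_scope.
Local Open Scope quotient_scope.

Section LmodQuotient.
Variables (K : pzRingType) (V : lmodType K) (S : submodClosed V).

(* [Quotient.quot] expects a [zmodClosed] predicate, and closure under
   opposite is not part of [submodClosed]. *)
Definition submod_pred : {pred V} := S.

Fact submod_pred_subsemimod_closed : GRing.subsemimod_closed submod_pred.
Proof. by split; [split=> [|u v]; [exact: rpred0|exact: rpredD]|exact: rpredZ]. Qed.

HB.instance Definition _ :=
  GRing.isSubmodClosed.Build K V submod_pred submod_pred_subsemimod_closed.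

Definition lmod_quot := Quotient.quot submod_pred.

HB.instance Definition _ := ZmodQuotient.on lmod_quot.

Lemma eq_lmod_quot (u v : V) : (u == v %[mod lmod_quot]) = (u - v \in S).
Proof. by rewrite -Quotient.idealrBE. Qed.

Definition lmod_quot_scale (c : K) := lift_op1 lmod_quot ( *:%R c).

Lemma pi_lmod_quot_scale c :
  {morph \pi_lmod_quot : v / c *: v >-> lmod_quot_scale c v}.
Proof.
move=> v; unlock lmod_quot_scale; apply/eqP; rewrite eq_lmod_quot.
by rewrite -scalerBr rpredZ // -eq_lmod_quot reprK.
Qed.
Canonical pi_lmod_quot_scale_morph c := PiMorph1 (pi_lmod_quot_scale c).

Fact lmod_quot_scalerA c d (x : lmod_quot) :
  lmod_quot_scale c (lmod_quot_scale d x) = lmod_quot_scale (c * d) x.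
Proof. by rewrite -[x]reprK !piE scalerA. Qed.

Fact lmod_quot_scale1r : left_id 1 lmod_quot_scale.
Proof. by move=> x; rewrite -[x]reprK !piE scale1r. Qed.

Fact lmod_quot_scalerDr : right_distributive lmod_quot_scale +%R.
Proof. by move=> c x y; rewrite -[x]reprK -[y]reprK !piE scalerDr. Qed.

Fact lmod_quot_scalerDl x : {morph lmod_quot_scale^~ x : c d / c + d}.
Proof. by move=> c d; rewrite -[x]reprK !piE scalerDl. Qed.

HB.instance Definition _ :=
  GRing.Zmodule_isLmodule.Build K lmod_quot lmod_quot_scalerA
    lmod_quot_scale1r lmod_quot_scalerDr lmod_quot_scalerDl.

Definition lmod_pi (v : V) : lmod_quot := \pi v.

Fact lmod_pi_is_linear : linear lmod_pi.
Proof. by move=> c u v; rewrite /lmod_pi raddfD /= pi_lmod_quot_scale. Qed.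

HB.instance Definition _ :=
  GRing.isLinear.Build K V lmod_quot *:%R lmod_pi lmod_pi_is_linear.

End LmodQuotient.

(* Proper two-sided ideals: [algType] requires [1 != 0], hence [ideal2_1]. *)
Record ideal2 (K : pzRingType) (A : algType K) := Ideal2 {
  ideal2_submod :> submodClosed A;
  ideal2_1 : 1 \notin ideal2_submod;
  ideal2_mull : forall a, {in ideal2_submod, forall u, a * u \in ideal2_submod};
  ideal2_mulr : forall a, {in ideal2_submod, forall u, u * a \in ideal2_submod}
}.

Section AlgQuotient.
Variables (K : pzRingType) (A : algType K) (I : ideal2 A).

Definition alg_quot := lmod_quot I.

HB.instance Definition _ := ZmodQuotient.on alg_quot.
HB.instance Definition _ := GRing.Lmodule.on alg_quot.

Definition alg_quot_one : alg_quot := lift_cst alg_quot 1.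
Definition alg_quot_mul := lift_op2 alg_quot *%R.

Canonical pi_alg_quot_one_morph := PiConst alg_quot_one.

Lemma pi_alg_quot_mul :
  {morph \pi_alg_quot : x y / x * y >-> alg_quot_mul x y}.
Proof.
move=> x y; unlock alg_quot_mul; apply/eqP; rewrite eq_lmod_quot.
rewrite -[_ * _](addrNK (x * repr (\pi_alg_quot y))) -mulrBr -addrA -mulrBl.
by rewrite rpredD ?(ideal2_mull x) ?(ideal2_mulr (repr _)) //
  -(eq_lmod_quot I) reprK.
Qed.
Canonical pi_alg_quot_mul_morph := PiMorph2 pi_alg_quot_mul.

Fact alg_quot_mulA : associative alg_quot_mul.
Proof. by move=> x y z; rewrite -[x]reprK -[y]reprK -[z]reprK !piE mulrA. Qed.

Fact alg_quot_mul1r : left_id alg_quot_one alg_quot_mul.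
Proof. by move=> x; rewrite -[x]reprK !piE mul1r. Qed.

Fact alg_quot_mulr1 : right_id alg_quot_one alg_quot_mul.
Proof. by move=> x; rewrite -[x]reprK !piE mulr1. Qed.

Fact alg_quot_mulDl : left_distributive alg_quot_mul +%R.
Proof. by move=> x y z; rewrite -[x]reprK -[y]reprK -[z]reprK !piE mulrDl. Qed.

Fact alg_quot_mulDr : right_distributive alg_quot_mul +%R.
Proof. by move=> x y z; rewrite -[x]reprK -[y]reprK -[z]reprK !piE mulrDr. Qed.

Fact alg_quot_oner_neq0 : alg_quot_one != 0.
Proof. by rewrite piE Quotient.equivE subr0; exact: ideal2_1. Qed.

HB.instance Definition _ :=
  GRing.Zmodule_isNzRing.Build alg_quot alg_quot_mulA alg_quot_mul1r
    alg_quot_mulr1 alg_quot_mulDl alg_quot_mulDr alg_quot_oner_neq0.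

Definition alg_pi : A -> alg_quot := lmod_pi I.

HB.instance Definition _ := GRing.Linear.on alg_pi.

Fact alg_pi_monoid_morphism : monoid_morphism alg_pi.
Proof. by split=> [|x y]; rewrite /alg_pi /lmod_pi [RHS]piE. Qed.

HB.instance Definition _ :=
  GRing.isMonoidMorphism.Build A alg_quot alg_pi alg_pi_monoid_morphism.

Lemma alg_piK : cancel repr alg_pi.
Proof. exact: reprK. Qed.

Fact alg_quot_scalerAl c (x y : alg_quot) : c *: (x * y) = c *: x * y.
Proof.
by rewrite -[x]alg_piK -[y]alg_piK -rmorphM -!linearZ -rmorphM /= scalerAl.
Qed.

HB.instance Definition _ :=
  GRing.Lmodule_isLalgebra.Build K alg_quot alg_quot_scalerAl.

Fact alg_quot_scalerAr c (x y : alg_quot) : c *: (x * y) = x * (c *: y).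
Proof.
by rewrite -[x]alg_piK -[y]alg_piK -rmorphM -!linearZ -rmorphM /= scalerAr.
Qed.

HB.instance Definition _ :=
  GRing.Lalgebra_isAlgebra.Build K alg_quot alg_quot_scalerAr.
HB.instance Definition _ := GRing.RMorphism.on alg_pi.
End AlgQuotient.

(* [{malg R[M]}] is declared as an [algType] only for commutative monoids [M];
   this alias carries the structure for the free monoid. *)
Definition free_alg (K : comNzRingType) (G : choiceType) := {malg K[{fmonom G}]}.

Section FreeAlgebra.
Variables (K : comNzRingType) (G : choiceType).

HB.instance Definition _ := GRing.Lalgebra.on (free_alg K G).

Fact malg_scalerAr c (x y : {malg K[{fmonom G}]}) : c *: (x * y) = x * (c *: y).
Proof.
have comm_c : malgC c * x = x * malgC c.
  rewrite !malgM_def fgmulUg fgmulgU; apply: eq_bigr => m _.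
  by rewrite mul1m mulm1 mulrC.
transitivity (malgC c * (x * y)); first exact/esym/mul_malgC.
transitivity (x * (malgC c * y)); last by congr (x * _); exact: mul_malgC.
transitivity (malgC c * x * y); first exact: fgmulA.
by rewrite comm_c; exact/esym/fgmulA.
Qed.

Fact free_alg_scalerAr c (x y : free_alg K G) : c *: (x * y) = x * (c *: y).
Proof. exact: malg_scalerAr. Qed.

HB.instance Definition _ :=
  GRing.Lalgebra_isAlgebra.Build K (free_alg K G) free_alg_scalerAr.

Definition free_gen (g : G) : free_alg K G := mkmalgU (fmu g) 1.

End FreeAlgebra.

Section IdealSpan.
Variables (K : pzRingType) (A : algType K) (S : A -> Prop).

Inductive ideal_span : A -> Prop :=
| ideal_span_0 : ideal_span 0
| ideal_span_add a r b x :
    S r -> ideal_span x -> ideal_span (a * r * b + x).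

Definition ideal_span_pred : {pred A} := fun x => `[< ideal_span x >].

Fact ideal_span_subsemimod_closed : GRing.subsemimod_closed ideal_span_pred.
Proof.
split; [split=> [|x y /asboolP Ix /asboolP Iy]|move=> c x /asboolP Ix].
- by apply/asboolP; exact: ideal_span_0.
- apply/asboolP; elim: Ix => [|a r b z Sr _ IH]; first by rewrite add0r.
  by rewrite -addrA; exact: ideal_span_add.
apply/asboolP; elim: Ix => [|a r b z Sr _ IH].
  by rewrite scaler0; exact: ideal_span_0.
by rewrite scalerDr !scalerAl; exact: ideal_span_add.
Qed.

HB.instance Definition _ :=
  GRing.isSubmodClosed.Build K A ideal_span_pred ideal_span_subsemimod_closed.

Fact ideal_span_mull a :
  {in ideal_span_pred, forall u, a * u \in ideal_span_pred}.
Proof.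
move=> u /asboolP Iu; apply/asboolP.
elim: Iu => [|b r c z Sr _ IH]; first by rewrite mulr0; exact: ideal_span_0.
by rewrite mulrDr !mulrA; exact: ideal_span_add.
Qed.

Fact ideal_span_mulr a :
  {in ideal_span_pred, forall u, u * a \in ideal_span_pred}.
Proof.
move=> u /asboolP Iu; apply/asboolP.
elim: Iu => [|b r c z Sr _ IH]; first by rewrite mul0r; exact: ideal_span_0.
by rewrite mulrDl -mulrA; exact: ideal_span_add.
Qed.

End IdealSpan.

Section CliffordWeyl.
Variables (K : comNzRingType) (n k : nat).

Definition cw_index := ('I_n + ('I_k + 'I_k))%type.

Local Notation F := (free_alg K cw_index).

Definition cw_omega (i : 'I_n) : F := free_gen K (inl i : cw_index).
Definition cw_p (i : 'I_k) : F := free_gen K (inr (inl i) : cw_index).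
Definition cw_q (i : 'I_k) : F := free_gen K (inr (inr i) : cw_index).

Inductive cw_relator : F -> Prop :=
| cw_rel_ww i j : cw_relator
    (cw_omega i * cw_omega j + cw_omega j * cw_omega i - 2 * (i == j)%:R)
| cw_rel_pq i j : cw_relator (cw_p i * cw_q j - cw_q j * cw_p i - (i == j)%:R)
| cw_rel_pp i j : cw_relator (cw_p i * cw_p j - cw_p j * cw_p i)
| cw_rel_qq i j : cw_relator (cw_q i * cw_q j - cw_q j * cw_q i)
| cw_rel_wp i j : cw_relator (cw_omega i * cw_p j + cw_p j * cw_omega i)
| cw_rel_wq i j : cw_relator (cw_omega i * cw_q j + cw_q j * cw_omega i).

(* Properness of the ideal is shown on the functions of
   [(s, m) : {0,1}^n * nat^k]: [omega_i] flips [s i] (Clifford action, up to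
   the sign of the bits below [i]), [p_j] and [q_j] act on [m] as in the
   Bargmann-Fock representation, twisted by the parity of [s] so that they
   anticommute with the [omega_i]. *)
Let X := (('I_n -> bool) * ('I_k -> nat))%type.

Let parity (s : 'I_n -> bool) : bool := \big[addb/false]_j s j.
Let parity_below (i : 'I_n) (s : 'I_n -> bool) : bool :=
  \big[addb/false]_(j < n | (j < i)%N) s j.
Let flip (i : 'I_n) (s : 'I_n -> bool) j := (j == i) (+) s j.
Let incr (i : 'I_k) (m : 'I_k -> nat) j := ((j == i) + m j)%N.
Let decr (i : 'I_k) (m : 'I_k -> nat) j := (m j - (j == i))%N.

Let act_coef (g : cw_index) (x : X) : K :=
  match g with
  | inl i => (-1) ^+ parity_below i x.1
  | inr (inl j) => (-1) ^+ parity x.1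
  | inr (inr j) => (-1) ^+ parity x.1 * (x.2 j)%:R
  end.

Let act_pt (g : cw_index) (x : X) : X :=
  match g with
  | inl i => (flip i x.1, x.2)
  | inr (inl j) => (x.1, incr j x.2)
  | inr (inr j) => (x.1, decr j x.2)
  end.

Let act_gen (g : cw_index) (v : X -> K) (x : X) : K :=
  act_coef g x * v (act_pt g x).
Let act_mon (v : X -> K) (m : seq cw_index) : X -> K := foldr act_gen v m.
Let act (a : F) (v : X -> K) (x : X) : K := mmap idfun (fun m : {fmonom cw_index} => act_mon v m x) a.

Let act_mon_sum (T : Type) (r : seq T) (c : T -> K) (u : T -> X -> K) m x :
  act_mon (fun y => \sum_(t <- r) c t * u t y) m x =
  \sum_(t <- r) c t * act_mon (u t) m x.
Proof.
elim: m x => [|g m IH] x //=; rewrite /act_gen -/(act_mon _ _) IH mulr_sumr.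
by apply: eq_bigr => t _; rewrite mulrCA.
Qed.

Let actD a b v x : act (a + b) v x = act a v x + act b v x.
Proof. exact: mmapD. Qed.

Let actN a v x : act (- a) v x = - act a v x.
Proof. exact: mmapN. Qed.

Let act0 v x : act 0 v x = 0.
Proof. exact: mmap0. Qed.

Let act_zero a x : act a (fun=> 0) x = 0.
Proof.
rewrite /act mmapE big1 // => m _.
suff -> : act_mon (fun=> 0) m x = 0 by rewrite mulr0.
elim: (m : seq _) x => [|g l IH] y //=.
by rewrite /act_gen -/(act_mon _ _) IH mulr0.
Qed.

Let act_gen_eval g v x : act (free_gen K g) v x = act_coef g x * v (act_pt g x).
Proof. by rewrite /act mmapU mul1r /= fmU. Qed.

Let actM a b v x : act (a * b) v x = act a (act b v) x.
Proof.
rewrite {1}/act malgME raddf_sum /= {1}/act mmapE; apply: eq_bigr => i _.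
rewrite raddf_sum /=.
have -> : act b v = fun y => \sum_(j <- msupp b) mcoeff j b * act_mon v j y.
  by apply/funext => y; rewrite /act mmapE.
rewrite act_mon_sum mulr_sumr; apply: eq_bigr => j _.
by rewrite mmapU /= -mulrA /act_mon -foldr_cat -fmM.
Qed.

Let act_nat (c : nat) v x : act c%:R v x = c%:R * v x.
Proof.
by rewrite -mpolyC_nat /act mmapU /= fm1.
Qed.

Let act_gen2 g h v x : act (free_gen K g * free_gen K h) v x =
  act_coef g x * (act_coef h (act_pt g x) * v (act_pt h (act_pt g x))).
Proof. by rewrite actM !act_gen_eval. Qed.

Let act_anticomm g h v x :
  act (free_gen K g * free_gen K h + free_gen K h * free_gen K g) v x =
  act_coef g x * (act_coef h (act_pt g x) * v (act_pt h (act_pt g x))) +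
  act_coef h x * (act_coef g (act_pt h x) * v (act_pt g (act_pt h x))).
Proof.
exact: etrans (actD _ _ _ _) (congr2 _ (act_gen2 _ _ _ _) (act_gen2 _ _ _ _)).
Qed.

Let act_comm g h v x :
  act (free_gen K g * free_gen K h - free_gen K h * free_gen K g) v x =
  act_coef g x * (act_coef h (act_pt g x) * v (act_pt h (act_pt g x))) -
  act_coef h x * (act_coef g (act_pt h x) * v (act_pt g (act_pt h x))).
Proof.
apply: etrans (actD _ _ _ _) (congr2 _ (act_gen2 _ _ _ _) _).
exact: etrans (actN _ _ _) (congr1 _ (act_gen2 _ _ _ _)).
Qed.

Let act_sub_nat a (c : nat) v x : act (a - c%:R) v x = act a v x - c%:R * v x.
Proof.
apply: etrans (actD _ _ _ _) (congr1 _ _).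
exact: etrans (actN _ _ _) (congr1 _ (act_nat _ _ _)).
Qed.

Let flipK i : involutive (flip i).
Proof. by move=> s; apply/funext => j; rewrite /flip addbA addbb. Qed.

Let flipC i j s : flip i (flip j s) = flip j (flip i s).
Proof. by apply/funext => l; rewrite /flip addbCA. Qed.

Let incrC i j m : incr i (incr j m) = incr j (incr i m).
Proof. by apply/funext => l; rewrite /incr addnCA. Qed.

Let decrC i j m : decr i (decr j m) = decr j (decr i m).
Proof. by apply/funext => l; rewrite /decr subnAC. Qed.

Let parity_flip i s : parity (flip i s) = ~~ parity s.
Proof.
rewrite /parity /flip big_split /= (bigD1 i) //= eqxx big1 ?addbF // => j.
by move/negPf.
Qed.

Let parity_below_flip i j s :
  parity_below i (flip j s) = (j < i)%N (+) parity_below i s.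
Proof.
rewrite /parity_below /flip big_split /=; congr (_ (+) _).
case: ltnP => [ji|ij]; last first.
  by rewrite big1 // => l li; apply/negbTE; apply: contraTneq li => ->; rewrite -leqNgt.
rewrite (bigD1 j) //= eqxx big1 // => l /andP[_ /negPf]; exact.
Qed.

Let sign_cancel (a b : bool) (t : K) : a != b ->
  (-1) ^+ a * t + (-1) ^+ b * t = 0.
Proof. by case: a b => [] [] // _; rewrite expr0 expr1 !mulN1r mul1r ?addNr ?addrN. Qed.

Let act_relator a v x : cw_relator a -> act a v x = 0.
Proof.
case: x => s m; case=> i j; rewrite /cw_omega /cw_p /cw_q.
- rewrite -natrM act_sub_nat act_anticomm /= !parity_below_flip flipC.
  have [->|neq_ij] := eqVneq i j.
    by rewrite ltnn addFb flipK !signrMK muln1 -mulr2n mulr_natl subrr.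
  rewrite muln0 mul0r subr0 !mulrA -!signr_addb.
  rewrite sign_cancel //; move: neq_ij; rewrite -val_eqE neq_ltn.
  by case: ltngtP => // _ _; case: (parity_below i s); case: (parity_below j s).
- rewrite act_sub_nat act_comm /=.
  rewrite -!mulrA signrMK [(m j)%:R * (_ * _)]mulrCA signrMK.
  have [<-|neq_ij] := eqVneq i j.
    have -> : decr i (incr i m) = m.
      by apply/funext => l; rewrite /decr /incr addKn.
    have -> : incr i m i = (m i).+1 by rewrite /incr eqxx.
    rewrite -natr1 mulrDl mul1r.
    have [mi0|mi_gt0] := posnP (m i); first by
      rewrite mi0 !mul0r add0r subr0 subrr.
    have -> : incr i (decr i m) = m; last by rewrite [X in X - _ - _]addrC addrK subrr.
    apply/funext => l; rewrite /decr /incr; case: eqP => [->|_].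
      by rewrite subnKC.
    by rewrite subn0.
  have -> : decr j (incr i m) = incr i (decr j m).
    apply/funext => l; rewrite /decr /incr.
    have [lj|_] := eqVneq l j; last by rewrite !subn0.
    by rewrite lj eq_sym (negPf neq_ij).
  have -> : incr i m j = m j by rewrite /incr eq_sym (negPf neq_ij).
  by rewrite mul0r subr0 subrr.
- by rewrite act_comm /= incrC subrr.
- rewrite act_comm /= decrC -!mulrA.
  have [->|neq_ij] := eqVneq i j; first by rewrite subrr.
  have -> : decr i m j = m j by rewrite /decr eq_sym (negPf neq_ij) subn0.
  have -> : decr j m i = m i by rewrite /decr (negPf neq_ij) subn0. 
  rewrite [(m i)%:R * (_ * _)]mulrCA [(m j)%:R * (_ * _)]mulrCA.
  by rewrite [(m i)%:R * _]mulrCA subrr.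
- rewrite act_anticomm /= parity_flip mulrCA; apply: sign_cancel.
  by case: (parity s).
- rewrite act_anticomm /= parity_flip.
  rewrite -!mulrA [X in X + _]mulrCA [(m j)%:R * (_ * _)]mulrCA.
  by apply: sign_cancel; case: (parity s).
Qed.

Let act_ideal a v x : ideal_span cw_relator a -> act a v x = 0.
Proof.
move=> Ia; elim: Ia v x => [|b r c y Sr _ IH] v x; first exact: act0.
rewrite actD IH addr0 -mulrA actM.
have -> : act (r * c) v = fun=> 0.
  by apply/funext => z; rewrite actM act_relator.
exact: act_zero.
Qed.

Fact cw_ideal_proper : 1 \notin ideal_span_pred cw_relator.
Proof.
apply/negP => /asboolP /(@act_ideal _ (fun=> 1) (fun=> false, fun=> 0%N)).
by rewrite (act_nat 1) mulr1 => /eqP; rewrite oner_eq0.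
Qed.

Definition cw_ideal : ideal2 F :=
  Ideal2 cw_ideal_proper (@ideal_span_mull _ _ cw_relator)
    (@ideal_span_mulr _ _ cw_relator).

(* The Clifford-Weyl algebra C(n, 2k): the third argument counts the pairs
   (p_i, q_i). *)
Definition clifford_weyl := alg_quot cw_ideal.

HB.instance Definition _ := GRing.Algebra.on clifford_weyl.
End CliffordWeyl.

Section Hochschild.
Variables (K : fieldType) (A : algType K).

Definition multilinear l : {pred ('I_l -> A) -> A} := fun f =>
  `[< forall (a : 'I_l -> A) (i : 'I_l),
        linear (fun x => f (@dfwith 'I_l (fun=> A) a i x)) >].

Fact multilinear_subsemimod_closed l : GRing.subsemimod_closed (@multilinear l).
Proof.
split; [split=> [|f g /asboolP lf /asboolP lg]|move=> c f /asboolP lf];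
  apply/asboolP => a i d x y /=.
- by rewrite scaler0 addr0.
- apply: etrans (congr2 +%R (lf a i d x y) (lg a i d x y)) _.
  by rewrite /= scalerDr addrACA.
- apply: etrans (congr1 ( *:%R c) (lf a i d x y)) _.
  by rewrite /= scalerDr !scalerA mulrC.
Qed.

HB.instance Definition _ l :=
  GRing.isSubmodClosed.Build K (('I_l -> A) -> A) (@multilinear l)
    (@multilinear_subsemimod_closed l).

Record cochain l := Cochain {
  cochain_val :> ('I_l -> A) -> A;
  _ : cochain_val \in @multilinear l
}.

HB.instance Definition _ l := [isSub for @cochain_val l].
HB.instance Definition _ l := [Choice of cochain l by <:].
HB.instance Definition _ l := [SubChoice_isSubLmodule of cochain l by <:].

(* (a_0, .., a_l) |-> (a_0, .., a_i * a_(i+1), .., a_l) *)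
Definition contract l (i : 'I_l) (a : 'I_l.+1 -> A) : 'I_l -> A := fun j =>
  if (j < i)%N then a (widen_ord (leqnSn l) j)
  else if j == i then a (widen_ord (leqnSn l) i) * a (lift ord0 i)
  else a (lift ord0 j).

Definition hoch_fun l (f : ('I_l -> A) -> A) (a : 'I_l.+1 -> A) : A :=
  a ord0 * f (a \o lift ord0)
  + \sum_(i < l) (-1) ^+ i.+1 * f (contract i a)
  + (-1) ^+ l.+1 * (f (a \o widen_ord (leqnSn l)) * a ord_max).

Let dfwithE l (a : 'I_l -> A) i x j :
  @dfwith _ (fun=> A) a i x j = if j == i then x else a j.
Proof.
by case: eqVneq => [->|ji]; [rewrite dfwith_in|rewrite dfwith_out // eq_sym].
Qed.

Let contract_dfwith l (t : 'I_l) (a : 'I_l.+1 -> A) i :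
  exists j u w, forall x, contract t (@dfwith _ (fun=> A) a i x) =
    @dfwith _ (fun=> A) (contract t a) j (u * x * w).
Proof.
have [it|ti|it] := ltngtP i t.
- exists (Ordinal (ltn_trans it (ltn_ord t))), 1, 1 => x; apply/funext => s.
  rewrite mul1r mulr1 dfwithE /contract !dfwithE -!val_eqE /= /bump /=.
  by do ?[case: ifP => //]; lia.
- have [it|it|it] := ltngtP i t.+1; first by lia.
    have jl : (i.-1 < l)%N by have := ltn_ord i; lia.
    exists (Ordinal jl), 1, 1 => x; apply/funext => s.
    rewrite mul1r mulr1 dfwithE /contract !dfwithE -!val_eqE /= /bump /=.
    by do ?[case: ifP => //]; lia.
  exists t, (a (widen_ord (leqnSn l) t)), 1 => x; apply/funext => s.
  rewrite mulr1 dfwithE /contract !dfwithE -!val_eqE /= /bump /=.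
  by do ?[case: ifP => //]; lia.
- exists t, 1, (a (lift ord0 t)) => x; apply/funext => s.
  rewrite mul1r dfwithE /contract !dfwithE -!val_eqE /= /bump /=.
  by do ?[case: ifP => //]; lia.
Qed.

Let cochain_linear l (f : cochain l) a i :
  linear (fun x => f (@dfwith 'I_l (fun=> A) a i x)).
Proof. by have /asboolP := valP f; exact. Qed.

Let head_linear l (f : cochain l) (a : 'I_l.+1 -> A) i : linear (fun x =>
  @dfwith _ (fun=> A) a i x ord0 * f (@dfwith _ (fun=> A) a i x \o lift ord0)).
Proof.
have [->|i0] := eqVneq i ord0.
  have E x : @dfwith _ (fun=> A) a ord0 x \o lift ord0 = a \o lift ord0.
    by apply/funext => j; rewrite /= dfwithE.
  by move=> c x y; rewrite !E !dfwith_in mulrDl scalerAl.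
have jl : (i.-1 < l)%N.
  by have := ltn_ord i; move: i0; rewrite -val_eqE /=; lia.
have E x : @dfwith _ (fun=> A) a i x \o lift ord0 =
           @dfwith _ (fun=> A) (a \o lift ord0) (Ordinal jl) x.
  apply/funext => s; rewrite /= !dfwithE -!val_eqE /= /bump /=.
  by move: i0; rewrite -val_eqE /=; do ?[case: ifP => //]; lia.
move=> c x y; rewrite !E !dfwith_out //.
by have /= -> := cochain_linear f (a \o lift ord0) (Ordinal jl) c x y;
  rewrite mulrDr scalerAr.
Qed.

Let tail_linear l (f : cochain l) (a : 'I_l.+1 -> A) i : linear (fun x =>
  f (@dfwith _ (fun=> A) a i x \o widen_ord (leqnSn l)) *
  @dfwith _ (fun=> A) a i x ord_max).
Proof.
have [->|il] := eqVneq i ord_max.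
  have E x : @dfwith _ (fun=> A) a ord_max x \o widen_ord (leqnSn l) =
             a \o widen_ord (leqnSn l).
    apply/funext => j; rewrite /= dfwithE -val_eqE /=.
    by have := ltn_ord j; case: ifP => //; lia.
  by move=> c x y; rewrite !E !dfwith_in mulrDr scalerAr.
have jl : (i < l)%N.
  by have := ltn_ord i; move: il; rewrite -val_eqE /=; lia.
have E x : @dfwith _ (fun=> A) a i x \o widen_ord (leqnSn l) =
           @dfwith _ (fun=> A) (a \o widen_ord (leqnSn l)) (Ordinal jl) x.
  by apply/funext => s; rewrite /= !dfwithE.
move=> c x y; rewrite !E !dfwith_out //.
by have /= -> := cochain_linear f _ (Ordinal jl) c x y; rewrite mulrDl scalerAl.
Qed.

Let contract_linear l (f : cochain l) (a : 'I_l.+1 -> A) i t : linear (fun x =>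
  f (contract t (@dfwith _ (fun=> A) a i x))).
Proof.
have [j [u [w E]]] := contract_dfwith t a i.
move=> c x y; rewrite !E mulrDr mulrDl -scalerAr -scalerAl.
exact: cochain_linear.
Qed.

Fact hoch_fun_multilinear l (f : cochain l) : hoch_fun f \in @multilinear l.+1.
Proof.
apply/asboolP => a i c x y; rewrite /hoch_fun.
have /= -> := head_linear f a i c x y.
have /= -> := tail_linear f a i c x y.
under eq_bigr => t _ do
  (have /= -> := contract_linear f a i t c x y; rewrite mulrDr -scalerAr).
rewrite big_split /= -scaler_sumr mulrDr -scalerAr !scalerDr.
by rewrite [RHS]addrACA; congr (_ + _); exact: addrACA.
Qed.

Definition hoch_diff l (f : cochain l) : cochain l.+1 :=
  Cochain (hoch_fun_multilinear f).

Let hoch_fun_linear l c (f g h : ('I_l -> A) -> A) a :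
  (forall b, h b = c *: f b + g b) ->
  hoch_fun h a = c *: hoch_fun f a + hoch_fun g a.
Proof.
move=> E; rewrite /hoch_fun !E; under eq_bigr do rewrite E mulrDr -scalerAr.
rewrite big_split /= -scaler_sumr !mulrDr mulrDl mulrDr -!scalerAr -scalerAl.
by rewrite -scalerAr !scalerDr [RHS]addrACA; congr (_ + _); exact: addrACA.
Qed.

Fact hoch_diff_is_linear l : linear (@hoch_diff l).
Proof.
by move=> c f g; apply/val_inj/funext => a; apply: hoch_fun_linear => b.
Qed.

HB.instance Definition _ l :=
  GRing.isLinear.Build K (cochain l) (cochain l.+1) *:%R (@hoch_diff l)
    (@hoch_diff_is_linear l).

Let ev l (f : ('I_l -> A) -> A) (b : nat -> A) : A :=
  b 0 * f (fun j => b j.+1) * b l.+1.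

Let nat_contract i (b : nat -> A) j :=
  if (j < i)%N then b j else if j == i then b i * b i.+1 else b j.+1.

Let ev_hoch_fun l (f : ('I_l -> A) -> A) b :
  ev (hoch_fun f) b = \sum_(i < l.+2) (-1) ^+ i * ev f (nat_contract i b).
Proof.
rewrite /ev /hoch_fun big_ord_recl big_ord_recr /= !mulrDr !mulrDl addrA.
congr (_ + _ + _).
- by rewrite mul1r /nat_contract /= !mulrA.
- rewrite mulr_sumr mulr_suml; apply: eq_bigr => i _.
  rewrite /= /bump leq0n add1n mulrA commr_sign -!mulrA; congr (_ * _).
  have -> : nat_contract i.+1 b 0 = b 0 by [].
  congr (_ * (f _ * _)).
  rewrite /nat_contract /=; have := ltn_ord i.
  by do ?[case: ifP => //]; lia.
rewrite /= /bump leq0n add1n mulrA commr_sign -!mulrA; congr (_ * _).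
rewrite /nat_contract /= ltnn eqxx; congr (_ * (f _ * _)).
by apply/funext => j; rewrite /= !ltnS ltn_ord.
Qed.

Let nat_contract_lt i b j : (j < i)%N -> nat_contract i b j = b j.
Proof. by rewrite /nat_contract => ->. Qed.

Let nat_contract_eq i b : nat_contract i b i = b i * b i.+1.
Proof. by rewrite /nat_contract ltnn eqxx. Qed.

Let nat_contract_gt i b j : (i < j)%N -> nat_contract i b j = b j.+1.
Proof. by rewrite /nat_contract; case: ltngtP. Qed.

Let nat_contractC i j b : (i <= j)%N ->
  nat_contract j (nat_contract i b) = nat_contract i (nat_contract j.+1 b).
Proof.
move=> ij; apply/funext => s.
have [si|is_|->] := ltngtP s i.
- by rewrite !nat_contract_lt //; lia.
- rewrite [RHS]nat_contract_gt //; have [sj|js|sj] := ltngtP s j.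
  + by rewrite (nat_contract_lt _ sj) (nat_contract_gt _ is_) nat_contract_lt.
  + by rewrite (nat_contract_gt _ js) !(nat_contract_gt b) //; lia.
  + by rewrite sj in is_ *; rewrite !nat_contract_eq !(nat_contract_gt b) //; lia.
rewrite [RHS]nat_contract_eq (@nat_contract_lt j.+1) //.
move: ij; rewrite leq_eqVlt => /predU1P[->|ij].
  rewrite !nat_contract_eq. by rewrite nat_contract_gt // mulrA.
by rewrite (nat_contract_lt _ ij) nat_contract_eq nat_contract_lt.
Qed.

Let hoch_fun_hoch_fun l (f : ('I_l -> A) -> A) a : hoch_fun (hoch_fun f) a = 0.
Proof.
pose b j := if j is j'.+1 then (if insub j' is Some i then a i else 1) else 1.
have -> : hoch_fun (hoch_fun f) a = ev (hoch_fun (hoch_fun f)) b.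
  rewrite /ev /b insubN ?ltnn // mul1r mulr1; congr (hoch_fun _ _).
  by apply/funext => j; rewrite valK.
rewrite ev_hoch_fun.
under eq_bigr => i _ do rewrite ev_hoch_fun mulr_sumr.
under eq_bigr => i _ do rewrite (bigID (fun j : 'I_l.+2 => i <= j)%N) /=.
rewrite big_split /= big_ord_recr /= [X in _ + X + _]big1 ?addr0; last first.
  by move=> j; rewrite leqNgt ltn_ord.
rewrite [X in _ + X]big_ord_recl /= [X in _ + (X + _)]big1 ?add0r; last first.
  by [].
rewrite [X in _ + X](exchange_big_dep xpredT) //= -big_split big1 // => i _ /=.
rewrite -[X in _ + X]opprK -sumrN; apply/eqP; rewrite subr_eq0; apply/eqP.
apply: eq_big => [j|j ij]; first by rewrite /bump /=; lia.
by rewrite nat_contractC // /bump /= add1n exprS mulN1r mulNr opprK !mulrA -!exprD addnC.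
Qed.
Lemma hoch_diff_diff l (f : cochain l) : hoch_diff (hoch_diff f) = 0.
Proof. by apply/val_inj/funext => a; exact: hoch_fun_hoch_fun. Qed.

Definition cocycle_pred l : {pred cochain l} := fun f => hoch_diff f == 0.

Definition coboundary_pred l : {pred cochain l} :=
  match l with
  | 0 => fun f => f == 0
  | l'.+1 => fun f => `[< exists g : cochain l', f = hoch_diff g >]
  end.

Fact cocycle_subsemimod_closed l : GRing.subsemimod_closed (@cocycle_pred l).
Proof.
split; [split=> [|f g /eqP df /eqP dg]|move=> c f /eqP df].
- by rewrite unfold_in linear0.
- by rewrite unfold_in linearD /= df dg addr0.
- by rewrite unfold_in linearZ /= df scaler0.
Qed.

HB.instance Definition _ l :=
  GRing.isSubmodClosed.Build K (cochain l) (@cocycle_pred l)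
    (@cocycle_subsemimod_closed l).

Record cocycle l := Cocycle {
  cocycle_val :> cochain l;
  _ : cocycle_val \in @cocycle_pred l
}.

HB.instance Definition _ l := [isSub for @cocycle_val l].
HB.instance Definition _ l := [Choice of cocycle l by <:].
HB.instance Definition _ l := [SubChoice_isSubLmodule of cocycle l by <:].

Definition coboundary l : {pred cocycle l} :=
  fun z => cocycle_val z \in @coboundary_pred l.

Fact coboundary_subsemimod_closed l : GRing.subsemimod_closed (@coboundary l).
Proof.
case: l => [|l]; (split; [split=> [|f g]|move=> c f]); rewrite !unfold_in /=.
- exact/eqP.
- by move=> /eqP f0 /eqP g0; apply/eqP; rewrite -[RHS]addr0 -{1}f0 -g0.
- by move=> /eqP f0; apply/eqP; rewrite -[RHS](scaler0 _ c) -f0.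
- by apply/asboolP; exists 0; rewrite raddf0.
- move=> /asboolP[f' fE] /asboolP[g' gE]; apply/asboolP.
  by exists (f' + g'); rewrite raddfD /= -fE -gE.
- move=> /asboolP[f' fE]; apply/asboolP.
  by exists (c *: f'); rewrite linearZ /= -fE.
Qed.

HB.instance Definition _ l :=
  GRing.isSubmodClosed.Build K (cocycle l) (@coboundary l)
    (@coboundary_subsemimod_closed l).

Definition hoch_cohom l := lmod_quot (@coboundary l).

HB.instance Definition _ l := GRing.Lmodule.on (hoch_cohom l).

End Hochschild.

(* Main.v *)
Require Import Defs.
From HB Require Import structures.
From mathcomp Require Import all_boot all_order all_algebra.
From mathcomp Require Import boolp functions.
From mathcomp Require Import finmap monalg.
From mathcomp Require Import reals complex.

(* Adding two generators w0, w1 amounts to passing to 2 x 2 matrices: with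
   g = i w0 w1 and e = (1 + g) / 2, the corner e C(n + 2, 2k) e is C(n, 2k) with
   generators g x e, and e is a full idempotent, sum_i u_i v_i = 1 with
   u = (e, w0 e) and v = (e, e w0). Inserting the u_i and v_i between the
   arguments of a cochain gives an explicit homotopy between the identity and
   the composite of restriction to the corner and extension from it. This
   reduces both claims to n = 0 and n = 1, respectively, and leaves the
   vanishing for the Weyl algebra.

   For the latter, a cocycle of degree m + 1 is a derivation with values in the
   bimodule of m-cochains, where the left action is pointwise and the right one
   is twisted by the differential. It is made to vanish on the generators x_j
   one after the other. The step for x_j asks for the surjectivity of the
   commutator with x_j on the elements commuting with the x_i, i < j. On the
   algebra itself this is integration along the variable conjugate to x_j. On
   (m + 1)-cochains f(y, ...), after a correction from degree m, it amounts to
   inverting f |-> x_j f(y) - f(x_j y), and this is done by a power series in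
   that operator and the locally nilpotent derivation dual to x_j. *)

Set Implicit Arguments.
Unset Strict Implicit.
Unset Printing Implicit Defensive.

Import Order.TTheory GRing.Theory Num.Theory.
Local Open Scope ring_scope.

(** * Curried cochains *)

Section CurriedCochains.
Variables (K : fieldType) (A : algType K).

(** Arguments are taken one at a time, so that actions, differentials and homotopies can be defined
    by recursion on the degree. The functions are arbitrary; multilinearity is the separate
    predicate [mlin]. *)
Fixpoint curried (m : nat) : lmodType K :=
  if m is m'.+1 then (A -> curried m' : lmodType K) else (A : lmodType K).

Lemma curriedDE m (f g : curried m.+1) a : (f + g : curried m.+1) a = f a + g a.
Proof. by []. Qed.
Lemma curriedNE m (f : curried m.+1) a : (- f : curried m.+1) a = - f a.
Proof. by []. Qed.
Lemma curriedZE m c (f : curried m.+1) a : (c *: f : curried m.+1) a = c *: f a.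
Proof. by []. Qed.
Lemma curried0E m a : (0 : curried m.+1) a = 0.
Proof. by []. Qed.
Lemma curried_sumE m (I : Type) (r : seq I) (P : pred I) (F : I -> curried m.+1) a :
  (\sum_(i <- r | P i) F i : curried m.+1) a = \sum_(i <- r | P i) F i a.
Proof. by elim/big_rec2: _ => // i x y _ <-. Qed.

Fixpoint lact m (a : A) : curried m -> curried m :=
  if m is m'.+1 then fun f b => lact a (f b) else fun f => a * f.

(* In positive degree this right action is not unital: [ract f 1] differs from
   [f] by [y |-> ract (f 1) y]. *)
Fixpoint ract m : curried m -> A -> curried m :=
  if m is m'.+1 then fun f a b => f (a * b) - ract (f a) b
  else fun f a => f * a.

Fixpoint mlin m : curried m -> Prop :=
  if m is m'.+1 then fun f => (linear f) /\ (forall a, mlin (f a))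
  else fun=> True.

(* [comm_act a f] is [(delta f)(a, -)], so [cdiff] is the Hochschild
   differential. *)
Definition comm_act m (a : A) (f : curried m) : curried m := lact a f - ract f a.

Definition cdiff m (f : curried m) : curried m.+1 := fun a => comm_act a f.

Lemma lact_linear m a : linear (@lact m a).
Proof.
elim: m => [|m IH] c f g /=; first by rewrite mulrDr scalerAr.
by apply/funext => b; exact: IH.
Qed.

Lemma lactD m a (f g : curried m) : lact a (f + g) = lact a f + lact a g.
Proof. by have := lact_linear a 1 f g; rewrite !scale1r. Qed.
Lemma lact0 m a : lact a (0 : curried m) = 0.
Proof. by apply: (addIr (lact a (0 : curried m))); rewrite -lactD !add0r. Qed.
Lemma lactZ m a c (f : curried m) : lact a (c *: f) = c *: lact a f.
Proof. by have := lact_linear a c f 0; rewrite lact0 !addr0. Qed.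
Lemma lactN m a (f : curried m) : lact a (- f) = - lact a f.
Proof. by rewrite -[- f]scaleN1r lactZ scaleN1r. Qed.
Lemma lactB m a (f g : curried m) : lact a (f - g) = lact a f - lact a g.
Proof. by rewrite lactD lactN. Qed.
Lemma lact_sum m a (I : Type) (r : seq I) (P : pred I) (F : I -> curried m) :
  lact a (\sum_(i <- r | P i) F i) = \sum_(i <- r | P i) lact a (F i).
Proof. by apply: (big_morph (lact a)) => [x y|]; rewrite ?lactD ?lact0. Qed.

Lemma lact_linearl m (f : curried m) : linear (fun a => lact a f).
Proof.
elim: m f => [|m IH] f c a b /=; first by rewrite mulrDl scalerAl.
by apply/funext => y; exact: IH.
Qed.

Lemma lactDl m a b (f : curried m) : lact (a + b) f = lact a f + lact b f.
Proof. by have := lact_linearl f 1 a b; rewrite !scale1r. Qed.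
Lemma lact0l m (f : curried m) : lact 0 f = 0.
Proof. by apply: (addIr (lact 0 f)); rewrite -lactDl !add0r. Qed.
Lemma lactZl m a c (f : curried m) : lact (c *: a) f = c *: lact a f.
Proof. by have := lact_linearl f c a 0; rewrite lact0l !addr0. Qed.
Lemma lactNl m a (f : curried m) : lact (- a) f = - lact a f.
Proof. by rewrite -[- a]scaleN1r lactZl scaleN1r. Qed.
Lemma lact_suml m (I : Type) (r : seq I) (P : pred I) (F : I -> A) (f : curried m) :
  lact (\sum_(i <- r | P i) F i) f = \sum_(i <- r | P i) lact (F i) f.
Proof. by apply: (big_morph (fun a => lact a f)) => [x y|]; rewrite ?lactDl ?lact0l. Qed.

Lemma lactA m a b (f : curried m) : lact a (lact b f) = lact (a * b) f.
Proof.
elim: m f => [|m IH] f /=; first by rewrite mulrA.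
by apply/funext => y; exact: IH.
Qed.

Lemma lact1 m (f : curried m) : lact 1 f = f.
Proof.
elim: m f => [|m IH] f /=; first by rewrite mul1r.
by apply/funext => y; exact: IH.
Qed.

Lemma ract_linear m a : linear (fun f : curried m => ract f a).
Proof.
elim: m a => [|m IH] a c f g /=; first by rewrite mulrDl scalerAl.
apply/funext => b; have /= -> := IH b c (f a) (g a).
rewrite !curriedDE !curriedZE scalerBr !opprD.
by rewrite [RHS]addrACA.
Qed.

Lemma ractD m a (f g : curried m) : ract (f + g) a = ract f a + ract g a.
Proof. by have := ract_linear a 1 f g; rewrite !scale1r. Qed.
Lemma ract0 m a : ract (0 : curried m) a = 0.
Proof. by apply: (addIr (ract (0 : curried m) a)); rewrite -ractD !add0r. Qed.
Lemma ractZ m a c (f : curried m) : ract (c *: f) a = c *: ract f a.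
Proof. by have := ract_linear a c f 0; rewrite ract0 !addr0. Qed.
Lemma ractN m a (f : curried m) : ract (- f) a = - ract f a.
Proof. by rewrite -[- f]scaleN1r ractZ scaleN1r. Qed.
Lemma ractB m a (f g : curried m) : ract (f - g) a = ract f a - ract g a.
Proof. by rewrite ractD ractN. Qed.
Lemma ract_sum m a (I : Type) (r : seq I) (P : pred I) (F : I -> curried m) :
  ract (\sum_(i <- r | P i) F i) a = \sum_(i <- r | P i) ract (F i) a.
Proof. by apply: (big_morph (fun f => ract f a)) => [x y|]; rewrite ?ractD ?ract0. Qed.

(** In positive degree the two terms built from [f a] cancel by the induction hypothesis, which
    leaves the associativity of the product. *)
Lemma ractA m a b (f : curried m) : ract (ract f a) b = ract f (a * b).
Proof.
elim: m a b f => [|m IH] a b f /=; first by rewrite mulrA.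
by apply/funext => y; rewrite ractB IH !mulrA opprB addrA addrNK.
Qed.

Lemma lract m a b (f : curried m) : ract (lact a f) b = lact a (ract f b).
Proof.
elim: m a b f => [|m IH] a b f /=; first by rewrite mulrA.
by apply/funext => y; rewrite IH lactB.
Qed.

Lemma ract_mlinl m (f : curried m) : mlin f -> linear (ract f).
Proof.
elim: m f => [|m IH] f /= => [_ c a b|[lf mf] c a b].
  by rewrite mulrDr scalerAr.
apply/funext => y; rewrite curriedDE curriedZE mulrDl -scalerAl !lf.
rewrite -[_ - ract (f b) y]/((fun=> f (b * y) - ract (f b) y) y).
by rewrite ractD ractZ scalerBr opprD addrACA.
Qed.

Lemma mlin0 m : mlin (0 : curried m).
Proof. by elim: m => [|m IH] //=; split=> // c a b; rewrite scaler0 addr0. Qed.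

Lemma mlin_comb m c (f g : curried m) : mlin f -> mlin g -> mlin (c *: f + g).
Proof.
elim: m f g => [|m IH] f g //= [lf mf] [lg mg]; split=> [d a b|a]; last exact: IH.
rewrite !curriedDE !curriedZE lf lg !scalerDr !scalerA mulrC.
by rewrite addrACA.
Qed.

Lemma mlinD m (f g : curried m) : mlin f -> mlin g -> mlin (f + g).
Proof. by move=> mf mg; rewrite -[f]scale1r; exact: mlin_comb. Qed.
Lemma mlinZ m c (f : curried m) : mlin f -> mlin (c *: f).
Proof. by move=> mf; rewrite -[_ *: f]addr0; apply: mlin_comb => //; exact: mlin0. Qed.
Lemma mlinN m (f : curried m) : mlin f -> mlin (- f).
Proof. by move=> mf; rewrite -scaleN1r; exact: mlinZ. Qed.
Lemma mlinB m (f g : curried m) : mlin f -> mlin g -> mlin (f - g).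
Proof. by move=> mf mg; apply: mlinD => //; exact: mlinN. Qed.
Lemma mlin_sum m (I : Type) (r : seq I) (P : pred I) (F : I -> curried m) :
  (forall i, mlin (F i)) -> mlin (\sum_(i <- r | P i) F i).
Proof. by move=> mF; elim/big_rec: _ => [|i x _ mx]; [exact: mlin0|exact: mlinD]. Qed.

Lemma mlin_lact m a (f : curried m) : mlin f -> mlin (lact a f).
Proof.
elim: m f => [|m IH] f //= [lf mf]; split=> [c x y|b]; last exact: IH.
by rewrite lf lactD lactZ.
Qed.

Lemma mlin_ract m a (f : curried m) : mlin f -> mlin (ract f a).
Proof.
elim: m a f => [|m IH] a f //= [lf mf]; split=> [c x y|b]; last first.
  by apply: mlinB => //; exact: IH.
rewrite mulrDr -scalerAr lf (ract_mlinl (mf a)) scalerBr opprD.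
by rewrite addrACA.
Qed.

Lemma mlin_comm_act m a (f : curried m) : mlin f -> mlin (comm_act a f).
Proof. by move=> mf; apply: mlinB; [exact: mlin_lact|exact: mlin_ract]. Qed.

Lemma mlin_cdiff m (f : curried m) : mlin f -> mlin (cdiff f).
Proof.
move=> mf; split=> [c x y|a]; last exact: mlin_comm_act.
rewrite /cdiff /comm_act lactDl lactZl (ract_mlinl mf) scalerBr opprD.
by rewrite addrACA.
Qed.

Lemma comm_actE m a b (f : curried m.+1) :
  comm_act a f b = lact a (f b) - f (a * b) + ract (f a) b.
Proof. by rewrite /comm_act curriedDE curriedNE /= opprB addrCA addrC. Qed.

Lemma comm_actD m a (f g : curried m) :
  comm_act a (f + g) = comm_act a f + comm_act a g.
Proof. by rewrite /comm_act lactD ractD opprD addrACA. Qed.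
Lemma comm_actN m a (f : curried m) : comm_act a (- f) = - comm_act a f.
Proof. by rewrite /comm_act lactN ractN opprD. Qed.
Lemma comm_actB m a (f g : curried m) :
  comm_act a (f - g) = comm_act a f - comm_act a g.
Proof. by rewrite comm_actD comm_actN. Qed.

(** The mixed terms [lact a (ract f b)] cancel because the two actions commute: this is the Leibniz
    rule of an inner derivation. *)
Lemma comm_actM m a b (f : curried m) :
  comm_act (a * b) f = lact a (comm_act b f) + ract (comm_act a f) b.
Proof. by rewrite /comm_act lactB ractB lract lactA ractA addrA addrNK. Qed.

(** The square of the differential vanishes; evaluated at [b], this is the Leibniz rule
    [comm_actM]. *)
Lemma comm_act_cdiff m a (f : curried m) : comm_act a (cdiff f) = 0.
Proof.
apply/funext => b; rewrite comm_actE /cdiff comm_actM opprD addrA subrr add0r.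
by rewrite addNr.
Qed.

End CurriedCochains.

(** * Vanishing for Weyl algebras *)

Section Commutator.
Variables (K : fieldType) (A : algType K).
Implicit Types z a b : A.

Definition commutator z a : A := z * a - a * z.

Fact commutator_is_linear z : linear (commutator z).
Proof.
move=> c a b; rewrite /commutator mulrDr mulrDl -scalerAr -scalerAl.
by rewrite scalerBr opprD addrACA.
Qed.
HB.instance Definition _ z :=
  GRing.isLinear.Build K A A *:%R (commutator z) (commutator_is_linear z).

Lemma commutatorM z a b :
  commutator z (a * b) = commutator z a * b + a * commutator z b.
Proof. by rewrite /commutator mulrBl mulrBr !mulrA addrA addrNK. Qed.

Lemma commutator1 z : commutator z 1 = 0.
Proof. by rewrite /commutator mulr1 mul1r subrr. Qed.

Lemma iter_commutator_linear z n : linear (iter n (commutator z)).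
Proof. by elim: n => [|n IH] c a b //=; rewrite IH linearP. Qed.

Lemma iter_commutator0 z n : iter n (commutator z) 0 = 0.
Proof. by elim: n => //= n ->; rewrite linear0. Qed.

(** Only two terms of the iterated Leibniz rule survive, since [commutator z] kills the scalar
    [commutator z x]. *)
Lemma iter_commutator_scalar z x c n a : commutator z x = c%:A ->
  iter n.+1 (commutator z) (x * a) =
  x * iter n.+1 (commutator z) a + (n.+1%:R * c) *: iter n (commutator z) a.
Proof.
move=> zx; elim: n => [|n IH]; first by rewrite /= commutatorM zx mulr_algl mul1r addrC.
rewrite iterS IH linearD linearZ /= commutatorM zx mulr_algl -/(iter n.+1 _ _).
by rewrite [_ + x * _]addrC -addrA -scalerDl -[n.+2]add1n natrD mulrDl mul1r.
Qed.

Lemma iter_commutator_eq0 z a n p : (n <= p)%N ->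
  iter n (commutator z) a = 0 -> iter p (commutator z) a = 0.
Proof. by move=> np; rewrite -(subnK np) iterD => ->; rewrite iter_commutator0. Qed.

Lemma commutatorX z s n : commutator z s = 1 ->
  commutator z (s ^+ n.+1) = n.+1%:R *: s ^+ n.
Proof.
move=> zs; elim: n => [|n IH]; first by rewrite expr1 zs expr0 scale1r.
rewrite exprS commutatorM zs mul1r IH -scalerAr -exprS.
by rewrite -[n.+2]add1n natrD scalerDl scale1r.
Qed.

End Commutator.

(** * The defect of left linearity in the first argument *)

Section PlainAction.
Variables (K : fieldType) (A : algType K) (m : nat).
Implicit Types f : curried A m.+1.

(** The part of [comm_act b f] without the right action. It is zero exactly when [f] is left linear
    with respect to [b]. *)
Definition left_act (b : A) f : curried A m.+1 := fun y => lact b (f y) - f (b * y).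

Lemma comm_act_left_act b f : f b = 0 -> comm_act b f = left_act b f.
Proof. by move=> fb; apply/funext => y; rewrite comm_actE fb ract0 addr0. Qed.

Lemma left_act0 b : left_act b 0 = 0.
Proof. by apply/funext => y; rewrite /left_act curried0E lact0 subr0. Qed.

Lemma mlin_left_act b f : mlin f -> mlin (left_act b f).
Proof.
move=> [lf mf]; split=> [c y z|y]; last by apply: mlinB; [exact/mlin_lact/mf|exact: mf].
rewrite /left_act lf lactD lactZ mulrDr -scalerAr lf scalerBr opprD.
by rewrite addrACA.
Qed.

Lemma mlin_left_act_iter b n f : mlin f -> mlin (iter n (left_act b) f).
Proof. by move=> mf; elim: n => //= n IH; exact: mlin_left_act. Qed.

(** The bracket of the two operators is the operator of the element [commutator b b'], and on a
    linear [f] the operator of a scalar is zero. *)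
Lemma left_actC b b' c f : commutator b b' = c%:A -> mlin f ->
  left_act b (left_act b' f) = left_act b' (left_act b f).
Proof.
move=> bb' [lf _]; apply/funext => y; apply/eqP; rewrite -subr_eq0; apply/eqP.
have fZ d z : f (d *: z) = d *: f z.
  have f0 : f 0 = 0 by have := lf (-1) 0 0; rewrite scaler0 addr0 scaleN1r addNr.
  by have := lf d z 0; rewrite f0 !addr0.
have fB z z' : f (z - z') = f z - f z'.
  by have := lf (-1) z' z; rewrite !scaleN1r ![- _ + _]addrC.
transitivity (lact (commutator b b') (f y) - f (commutator b b' * y)).
  rewrite /left_act /commutator !lactB !lactA mulrBl fB lactDl lactNl -!mulrA.
  rewrite !opprB addrACA !subrKA [LHS]addrACA [RHS]addrACA.
  by congr (_ + _); rewrite addrC.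
by rewrite bb' mulr_algl fZ lactZl lact1 subrr.
Qed.

End PlainAction.

(** * Vanishing for generators with conjugate elements *)

Section WeylVanishing.
Variables (K : numFieldType) (A : algType K) (N : nat) (x t : 'I_N -> A).
Hypothesis tx : forall i j, commutator (t j) (x i) = (i == j)%:R.
Hypothesis xx : forall i j, exists c, commutator (x i) (x j) = c%:A.
Hypothesis gen : forall S : A -> Prop, S 1 ->
  (forall c a b, S a -> S b -> S (c *: a + b)) ->
  (forall i a, S a -> S (x i * a)) -> forall a, S a.

(** Induction along words in the generators: by [iter_commutator_scalar], a further factor [x i]
    raises the nilpotency index by at most one. *)
Lemma commutator_locally_nilpotent z : (forall i, exists c, commutator z (x i) = c%:A) ->
  forall a, exists n, iter n (commutator z) a = 0.
Proof.
move=> zx; apply: gen => [|c a b [n an] [p bp]|i a [n an]].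
- by exists 1; rewrite /= commutator1.
- exists (maxn n p); rewrite iter_commutator_linear.
  rewrite (iter_commutator_eq0 _ an) ?leq_maxl //.
  by rewrite (iter_commutator_eq0 _ bp) ?leq_maxr // scaler0 addr0.
have [c zc] := zx i; exists n.+1.
by rewrite (iter_commutator_scalar _ _ zc) /= an linear0 mulr0 scaler0 addr0.
Qed.

Lemma tx_scalar j i : exists c, commutator (t j) (x i) = c%:A.
Proof. by exists (i == j)%:R; rewrite tx scaler_nat. Qed.

(** Some nilpotency index, not necessarily the least one; by [primitiveE] the choice does not affect
    the sums. *)
Let depth j a : {n | iter n (commutator (t j)) a = 0} :=
  cid (commutator_locally_nilpotent (tx_scalar j) a).

Section Primitive.
Variables (m : nat) (j : 'I_N) (G : curried A m.+1).
Hypothesis mG : mlin G.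

Let D := commutator (t j).
Let H r := iter r (left_act (x j)) G.

Let term r a : curried A m := - (r.+1`!%:R^-1 *: H r (iter r.+1 D a)).

(* The series [- \sum_r (left_act (x j))^r G \o D^(r+1) / (r+1)!] is locally
   finite because [D] is locally nilpotent; it inverts [left_act (x j)]
   because [D^(r+1) (x j * y) = x j * D^(r+1) y + (r+1) D^r y]. *)
Definition primitive : curried A m.+1 := fun a =>
  \sum_(r < sval (depth j a)) term r a.

Let mH r : mlin (H r).
Proof. exact: mlin_left_act_iter. Qed.

Let H0 r : H r 0 = 0.
Proof.
by have [lH _] := mH r; have := lH (-1) 0 0; rewrite scaler0 addr0 scaleN1r addNr.
Qed.

Let term_eq0 r a n : iter n D a = 0 -> (n <= r.+1)%N -> term r a = 0.
Proof. by move=> an nr; rewrite /term (iter_commutator_eq0 nr an) H0 scaler0 oppr0. Qed.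

(** Terms past a nilpotency index vanish. Sums attached to different elements can therefore be
    compared over a common range. *)
Lemma primitiveE n a : iter n D a = 0 -> primitive a = \sum_(0 <= r < n) term r a.
Proof.
have wlog_le p q : iter p D a = 0 -> (p <= q)%N ->
    \sum_(0 <= r < q) term r a = \sum_(0 <= r < p) term r a.
  move=> ap pq; rewrite (big_cat_nat (leq0n p) pq) /= [X in _ + X]big_nat_cond [X in _ + X]big1 ?addr0 //.
  by move=> r /andP[/andP[pr _] _]; apply: term_eq0 ap _; exact: leqW.
move=> an; rewrite /primitive; case: (depth j a) => p ap /=.
rewrite -(big_mkord xpredT (term^~ a)).
by case: (leqP p n) => [pn|/ltnW np]; [rewrite (wlog_le p n)|rewrite (wlog_le n p)].
Qed.

Lemma mlin_primitive : mlin primitive.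
Proof.
split=> [c a b|a]; last first.
  by apply: mlin_sum => r; have [_ mHr] := mH r; exact/mlinN/mlinZ/mHr.
have [[n an] [p bp]] := (depth j a, depth j b).
have {}an : iter (maxn n p) D a = 0 by exact: iter_commutator_eq0 (leq_maxl _ _) an.
have {}bp : iter (maxn n p) D b = 0 by exact: iter_commutator_eq0 (leq_maxr _ _) bp.
have ab : iter (maxn n p) D (c *: a + b) = 0.
  by rewrite iter_commutator_linear an bp scaler0 addr0.
rewrite (primitiveE an) (primitiveE bp) (primitiveE ab) scaler_sumr -big_split /=.
apply: eq_bigr => r _; rewrite /term -/(iter r.+1 D _) iter_commutator_linear.
have [lH _] := mH r; rewrite lH scalerDr opprD scalerN !scalerA.
by rewrite mulrC.
Qed.

Lemma primitive_eq0 a : D a = 0 -> primitive a = 0.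
Proof.
move=> Da; rewrite (@primitiveE 1) // big_nat1.
by apply: term_eq0 (_ : iter 1 D a = 0) _.
Qed.

Lemma left_act_primitive : left_act (x j) primitive = G.
Proof.
apply/funext => y; have [n yn] := depth j y.
(* The factor [x j] may raise the index by one, hence the common range [n.+1]. *)
have xyn : iter n.+1 D (x j * y) = 0.
  rewrite (iter_commutator_scalar _ _ (c := 1)) ?tx ?eqxx ?scale1r //.
  by rewrite (iter_commutator_eq0 (leqnSn n) yn) yn mulr0 scaler0 addr0.
have {}yn : iter n.+1 D y = 0 := iter_commutator_eq0 (leqnSn n) yn.
rewrite /left_act (primitiveE yn) (primitiveE xyn) lact_sum -sumrB.
(* The summand at [r] is [u r.+1 - u r], and the sum telescopes to [- u 0 = G y] because
   [iter n.+1 D y = 0]. *)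
pose u r := - ((r`!)%:R^-1 *: H r (iter r D y)).
rewrite (eq_bigr (fun r => u r.+1 - u r)); last first.
  move=> r _; rewrite /term lactN lactZ.
  rewrite (iter_commutator_scalar _ _ (c := 1)) ?tx ?eqxx ?scale1r // mulr1.
  have [lH _] := mH r; rewrite [x j * _ + _]addrC lH opprK /u.
  rewrite -[H r.+1 _]/(lact (x j) (H r (iter r.+1 D y)) - H r (x j * iter r.+1 D y)).
  rewrite scalerDr scalerBr opprB opprK addrCA [RHS]addrC; congr (_ + _).
    by rewrite scalerA factS natrM invfM mulrAC mulVf ?mul1r // pnatr_eq0.
  by rewrite addrC.
rewrite telescope_sumr // /u yn H0 scaler0 oppr0 sub0r opprK.
by rewrite fact0 invr1 scale1r.
Qed.

(** Since [t j] commutes with [x i], the derivation [D] commutes with left multiplication by [x i];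
    and each [H r] inherits left linearity from [G] by [left_actC]. *)
Lemma left_act_primitive0 i : i != j -> left_act (x i) G = 0 ->
  left_act (x i) primitive = 0.
Proof.
move=> ij iG; apply/funext => y; have [n yn] := depth j y.
have xD r : iter r D (x i * y) = x i * iter r D y.
  by elim: r => //= r ->; rewrite [D _]commutatorM tx (negPf ij) mul0r add0r.
have xyn : iter n D (x i * y) = 0 by rewrite xD yn mulr0.
rewrite /left_act (primitiveE yn) (primitiveE xyn) lact_sum -sumrB big1 // => r _.
rewrite /term lactN lactZ xD -opprD -scalerBr.
have [c xc] := xx i j.
have : left_act (x i) (H r) = 0.
  rewrite /H; elim: r => //= r IH.
  by rewrite (left_actC xc (mH r)) IH left_act0.
by move=> /(congr1 (fun f => f (iter r.+1 D y))); rewrite /left_act => ->; rewrite scaler0 oppr0.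
Qed.

End Primitive.

(* The element 1 takes part next to [x 0, .., x (j - 1)] because of the
   non-unital right action: [comm_act 1 f = f - ract f 1]. *)
Definition commutes_below j m (f : curried A m) :=
  comm_act 1 f = 0 /\ forall i : 'I_N, (i < j)%N -> comm_act (x i) f = 0.

(* [comm_act a G = 0] says that [G] is a derivation in the pairs [(a, y)]; the
   question is whether [G] is inner on [1, x 0, .., x (j - 1)]. *)
Definition degree1_exact j m := forall G : curried A m.+1, mlin G ->
  commutes_below j G -> exists2 F : curried A m, mlin F &
  comm_act 1 F = G 1 /\ forall i : 'I_N, (i < j)%N -> comm_act (x i) F = G (x i).

Definition commutator_onto (j : 'I_N) m := forall f : curried A m, mlin f ->
  commutes_below j f -> exists2 F : curried A m, mlin F &
  commutes_below j F /\ comm_act (x j) F = f.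

Lemma mlin_scale_sub m (G : curried A m.+1) : mlin G ->
  (forall c a, G (c *: a) = c *: G a) /\ (forall a b, G (a - b) = G a - G b).
Proof.
move=> [lG _].
have G0 : G 0 = 0 by have := lG (-1) 0 0; rewrite scaler0 addr0 scaleN1r addNr.
split=> [c a|a b]; first by have := lG c a 0; rewrite G0 !addr0.
by have := lG (-1) b a; rewrite !scaleN1r ![- _ + _]addrC.
Qed.

(** The witness is [G 1]: evaluating [comm_act 1 G = 0] at 1 gives [ract (G 1) 1 = 0]. *)
Lemma degree1_exact0 m : degree1_exact 0 m.
Proof.
move=> G [lG mG] [G1 _]; exists (G 1); first exact: mG.
split=> //.
have := congr1 (fun f => f 1) G1; rewrite curried0E comm_actE lact1 mulr1 subrr add0r.
by rewrite /comm_act lact1 => ->; rewrite subr0.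
Qed.

(** Subtracting [cdiff F0] leaves a derivation [H] that vanishes on 1 and on the earlier [x i]. Its
    value at [x j] then commutes with these, so surjectivity provides a correction [f'] that settles
    [x j] without disturbing the earlier values. *)
Lemma degree1_exactS (j : 'I_N) m :
  degree1_exact j m -> commutator_onto j m -> degree1_exact j.+1 m.
Proof.
move=> exj onj G mG [G1 Gx].
have [F0 mF0 [F01 F0x]] : exists2 F0 : curried A m, mlin F0 &
    comm_act 1 F0 = G 1 /\
    forall i : 'I_N, (i < j)%N -> comm_act (x i) F0 = G (x i).
  by apply: exj => //; split=> // i ij; apply: Gx; exact: ltnW.
pose H := G - cdiff F0 : curried A m.+1.
have mH : mlin H by apply: mlinB => //; exact: mlin_cdiff.
have [HZ HB] := mlin_scale_sub mH.
have H1 : H 1 = 0 by rewrite /H curriedDE curriedNE /cdiff F01 subrr.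
have Hx (i : 'I_N) : (i < j)%N -> H (x i) = 0.
  by move=> ij; rewrite /H curriedDE curriedNE /cdiff F0x // subrr.
have Hder (i : 'I_N) y : (i <= j)%N -> H (x i * y) = lact (x i) (H y) + ract (H (x i)) y.
  move=> ij; have : comm_act (x i) H y = 0.
    by rewrite /H comm_actB comm_act_cdiff subr0 Gx.
  rewrite comm_actE => /eqP; rewrite addrAC subr_eq0 => /eqP <-.
  by [].
have [f' mf' [[f'1 f'x] f'j]] : exists2 F : curried A m, mlin F &
    commutes_below j F /\ comm_act (x j) F = H (x j).
  apply: onj; first by have [_ mHa] := mH; exact: mHa.
  split=> [|i ij].
    have := Hder j 1 (leqnn j); rewrite mulr1 H1 lact0 add0r /comm_act lact1 => <-.
    by rewrite subrr.
  (* [H] kills the scalar [x i * x j - x j * x i]; by [Hder] and [H (x i) = 0] this says that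
     [comm_act (x i) (H (x j)) = 0]. *)
  have [c xc] := xx i j.
  have := HB (x i * x j) (x j * x i); rewrite -/(commutator (x i) (x j)) xc HZ H1 scaler0.
  rewrite (Hder i _ (ltnW ij)) (Hder j _ (leqnn j)) (Hx i ij) ract0 addr0 lact0 add0r.
  by rewrite /comm_act => <-.
exists (F0 + f'); first exact: mlinD.
split=> [|i]; first by rewrite comm_actD F01 f'1 addr0.
rewrite ltnS leq_eqVlt => /predU1P[/val_inj ->|ij].
  by rewrite comm_actD f'j /H curriedDE curriedNE /cdiff addrC addrNK.
by rewrite comm_actD F0x // f'x // addr0.
Qed.

(** The solution is the primitive of the corrected cochain [G']. It vanishes on 1 and on the [x i]
    with [i < j], because [t j] commutes with them, and for these elements [comm_act] therefore
    agrees with [left_act]. *)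
Lemma commutator_ontoS (j : 'I_N) m :
  degree1_exact j m -> commutator_onto j m.+1.
Proof.
move=> exj G mG [G1 Gx]; have [F mF [F1 Fx]] := exj G mG (conj G1 Gx).
(* Adding [y |-> ract F y] makes [G] left linear for the [x i], [i < j]. *)
pose G' : curried A m.+1 := fun y => G y + ract F y.
have mG' : mlin G'.
  have [lG mGa] := mG; split=> [c a b|a]; last by apply: mlinD; [exact: mGa|exact: mlin_ract].
  by rewrite /G' lG (ract_mlinl mF) scalerDr addrACA.
have G'x (i : 'I_N) : (i < j)%N -> left_act (x i) G' = 0.
  move=> ij; apply/funext => y; rewrite /left_act /G' curried0E lactD.
  have := congr1 (fun f => f y) (Gx i ij).
  rewrite curried0E comm_actE -(Fx i ij) /comm_act ractB lract ractA opprD addrACA.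
  by [].
have G'1 : G' 1 = F.
  by rewrite /G' -F1 /comm_act lact1 addrNK.
have Lj := left_act_primitive j mG'.
have Li (i : 'I_N) : (i < j)%N -> left_act (x i) (primitive j G') = 0.
  by move=> ij; apply: left_act_primitive0 => //; [rewrite -val_eqE neq_ltn ij|exact: G'x].
exists (primitive j G'); first exact: mlin_primitive.
have P1 : primitive j G' 1 = 0 by apply: primitive_eq0 => //; exact: commutator1.
split; first split=> [|i ij].
- rewrite comm_act_left_act //; apply/funext => y.
  by rewrite /left_act lact1 mul1r subrr.
- rewrite comm_act_left_act ?Li //; apply: primitive_eq0 => //.
  by rewrite tx -val_eqE (ltn_eqF ij).
apply/funext => y; rewrite comm_actE.
have := congr1 (fun f => f y) Lj; rewrite /left_act => ->.
(* At 1 the equation gives [primitive j G' (x j) = - F], so the right-action term of [comm_actE]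
   takes the correction back. *)
have := congr1 (fun f => f 1) Lj; rewrite /left_act P1 lact0 sub0r mulr1 G'1.
by move/eqP; rewrite eqr_oppLR => /eqP ->; rewrite ractN /G' addrK.
Qed.

(* Solves [commutator z y = s ^+ r * b] for [b] of nilpotency index [n], by
   induction on [n]: [commutator z (s ^+ r.+1 * b)] is
   [r.+1 *: (s ^+ r * b) + s ^+ r.+1 * commutator z b]. *)
Lemma commutator_solve (z s : A) (S : A -> Prop) :
  commutator z s = 1 -> (forall c a b, S a -> S b -> S (c *: a + b)) ->
  (forall a, S a -> S (s * a)) -> (forall a, S a -> S (commutator z a)) ->
  S 0 -> forall n b r, iter n (commutator z) b = 0 -> S b ->
  exists2 y, S y & commutator z y = s ^+ r * b.
Proof.
move=> zs Scomb Ss Sz S0; elim=> [|n IH] b r /=.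
  by move=> -> _; exists 0 => //; rewrite linear0 mulr0.
rewrite -iterS iterSr => bn Sb.
have [y Sy yE] := IH (commutator z b) r.+1 bn (Sz _ Sb).
exists (r.+1%:R^-1 *: (s ^+ r.+1 * b - y)).
  rewrite -[_ *: _]addr0; apply: (Scomb) => //; rewrite addrC -scaleN1r.
  apply: (Scomb) => //; elim: r.+1 => [|p IHp]; first by rewrite mul1r.
  by rewrite exprS -mulrA; exact: Ss.
rewrite linearZ linearB /= commutatorM (commutatorX _ zs) yE addrK -scalerAl scalerA.
by rewrite mulVf ?scale1r // pnatr_eq0.
Qed.

Section Onto0.
Variables (s : 'I_N -> A).
Hypothesis xs : forall j, commutator (x j) (s j) = 1.
Hypothesis xs0 : forall i j, i != j -> commutator (x i) (s j) = 0.

(** In degree 0 [comm_act] is the commutator, and [s j] is the variable of integration. The elements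
    commuting with the earlier [x i] form a set [S] stable under [s j] and [commutator (x j)], so
    the solution stays in [S]. *)
Lemma commutator_onto0 j : commutator_onto j 0.
Proof.
move=> f _ [_ fx].
pose S (a : A) := forall i : 'I_N, (i < j)%N -> commutator (x i) a = 0.
have [n fn] := commutator_locally_nilpotent (xx j) f.
have [||||y Sy yE] := @commutator_solve (x j) (s j) S (xs j) _ _ _ _ n f 0 fn fx.
- by move=> c a b Sa Sb i ij; rewrite linearP /= Sa // Sb // scaler0 addr0.
- by move=> a Sa i ij; rewrite commutatorM Sa // xs0 ?mul0r ?mulr0 ?addr0 // -val_eqE (ltn_eqF ij).
(* Stability under [commutator (x j)] holds because [commutator (x i) (x j)] is a scalar, hence
   central. *)
- move=> a Sa i ij; rewrite [commutator (x j) a]/commutator linearB /= !commutatorM Sa //.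
  have [c ->] := xx i j; rewrite mulr0 mul0r addr0 add0r mulr_algl mulr_algr.
  by rewrite subrr.
- by move=> i _; rewrite linear0.
exists y => //; split; last by rewrite -[RHS]mul1r.
by split=> [|i ij]; [rewrite /comm_act /= mul1r mulr1 subrr|exact: Sy].
Qed.

Theorem weyl_cocycle_coboundary m (G : curried A m.+1) : mlin G -> cdiff G = 0 ->
  exists2 F : curried A m, mlin F & cdiff F = G.
Proof.
have onto j p (jN : (j < N)%N) :
    degree1_exact j p -> commutator_onto (Ordinal jN) p.+1.
  by move=> ex; exact: (@commutator_ontoS (Ordinal jN)).
(* Outer induction on the degree, inner induction on the number of generators: the case
   [(p.+1, j.+1)] rests on [(p.+1, j)] and, through [commutator_ontoS], on [(p, j)]. *)
have exact_all p j : (j <= N)%N -> degree1_exact j p.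
  elim: p j => [|p IHp]; elim=> [|j IHj] jN; try exact: degree1_exact0.
    by apply: (@degree1_exactS (Ordinal jN)); [exact/IHj/ltnW|exact: commutator_onto0].
  apply: (@degree1_exactS (Ordinal jN)); first exact/IHj/ltnW.
  by apply: onto; exact/IHp/ltnW.
move=> mG dG; have Ga a : comm_act a G = 0 by rewrite -[LHS]/(cdiff G a) dG.
have [F mF [F1 Fx]] := exact_all m N (leqnn N) G mG (conj (Ga 1) (fun i _ => Ga (x i))).
exists F => //; apply/esym/eqP; rewrite -subr_eq0; apply/eqP.
(* [H] is a derivation that vanishes on 1 and on the generators, hence everywhere. *)
set H := G - cdiff F.
have mH : mlin H by apply: mlinB => //; exact: mlin_cdiff.
have Hder a y : H (a * y) = lact a (H y) + ract (H a) y.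
  have : comm_act a H y = 0 by rewrite /H comm_actB comm_act_cdiff subr0 Ga.
  by rewrite comm_actE => /eqP; rewrite addrAC subr_eq0 => /eqP <-.
apply/funext; apply: gen => [|c a b Ha Hb|i a Ha].
- by rewrite /H curriedDE curriedNE /cdiff F1 subrr.
- by have [lH _] := mH; rewrite lH Ha Hb !curried0E scaler0 addr0.
rewrite Hder Ha !curried0E lact0 add0r /H curriedDE curriedNE /cdiff Fx //.
by rewrite subrr ract0.
Qed.

End Onto0.
End WeylVanishing.

(** * Passing to a full corner *)

Section Homotopy.
Variables (K : fieldType) (A : algType K) (I : finType) (u v : I -> A).
Hypothesis uv1 : \sum_i u i * v i = 1.

(** [w] is a pending left factor. Either it becomes an argument of its own, or it is absorbed into
    [w * a * u j] with a change of sign, and [v j] is pending next. *)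
Fixpoint corner_insert m : curried A m.+1 -> A -> curried A m :=
  if m is m'.+1 then
    fun f w a => f w a - \sum_j corner_insert (f (w * a * u j)) (v j)
  else fun f w => f w.

(** Here every argument absorbs the pending factor, and the last one ends up on the right of the
    value. *)
Fixpoint corner_eval m : curried A m -> A -> curried A m :=
  if m is m'.+1 then fun f w a => \sum_j corner_eval (f (w * a * u j)) (v j)
  else fun f w => f * w.

(* Written out, [corner_homotopy f (a_1, .., a_m)] is the alternating sum over [p] of
   [u_i0 f(v_i0 a_1 u_i1, .., v_i(p-1) a_p u_ip, v_ip, a_(p+1), .., a_m)]. *)
Definition corner_homotopy m (f : curried A m.+1) : curried A m :=
  \sum_i lact (u i) (corner_insert f (v i)).

Definition corner_proj m (f : curried A m) : curried A m :=
  \sum_i lact (u i) (corner_eval f (v i)).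

Lemma corner_sum_mid w a : \sum_j w * a * u j * v j = w * a.
Proof. by rewrite -[RHS]mulr1 -uv1 mulr_sumr; apply: eq_bigr => j _; rewrite mulrA. Qed.

Lemma corner_insert_linear m w c (f g : curried A m.+1) :
  corner_insert (c *: f + g) w = c *: corner_insert f w + corner_insert g w.
Proof.
elim: m w f g => [|m IH] w f g //=; apply/funext => a.
rewrite !curriedDE !curriedZE (eq_bigr _ (fun j _ => IH _ _ _)) big_split /=.
by rewrite -scaler_sumr scalerBr opprD addrACA.
Qed.

Lemma corner_insert0 m w : corner_insert (0 : curried A m.+1) w = 0.
Proof. by have := corner_insert_linear w (-1) (0 : curried A m.+1) 0; rewrite scaleN1r addNr scaleN1r addNr. Qed.

Lemma corner_insertB m w (f g : curried A m.+1) :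
  corner_insert (f - g) w = corner_insert f w - corner_insert g w.
Proof. by have := corner_insert_linear w (-1) g f; rewrite !scaleN1r ![- _ + _]addrC. Qed.

Lemma corner_insert_sum m w (J : finType) (F : J -> curried A m.+1) :
  corner_insert (\sum_j F j) w = \sum_j corner_insert (F j) w.
Proof.
apply: (big_morph (fun f => corner_insert f w)) => [f g|]; last exact: corner_insert0.
by have := corner_insert_linear w 1 f g; rewrite !scale1r.
Qed.

Lemma corner_insert_lact m x w (f : curried A m.+1) :
  corner_insert (lact x f) w = lact x (corner_insert f w).
Proof.
elim: m f w => [|m IH] f w //=; apply/funext => a.
rewrite lactB lact_sum; congr (_ - _).
by apply: eq_bigr => j _; rewrite -IH.
Qed.

Lemma mlin_corner_insert m w (f : curried A m.+1) : mlin f -> mlin (corner_insert f w).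
Proof.
elim: m f w => [|m IH] f w [lf mf] //; split=> [c a b|a].
  have [lfw _] := mf w.
  rewrite /= lfw scalerBr scaler_sumr addrACA; congr (_ + _).
  rewrite -opprD -big_split; congr (- _); apply: eq_bigr => j _ /=.
  rewrite mulrDr mulrDl -scalerAr -scalerAl lf; exact: corner_insert_linear.
have [_ mfw] := mf w.
by apply: mlinB; [exact: mfw|apply: mlin_sum => j; apply: IH; exact: mf].
Qed.

Lemma mlin_sumE m (f : curried A m.+1) (J : finType) (F : J -> A) : mlin f ->
  f (\sum_j F j) = \sum_j f (F j).
Proof.
move=> [lf _]; apply: (big_morph f) => [a b|].
  by have := lf 1 a b; rewrite !scale1r.
by have := lf (-1) 0 0; rewrite scaler0 addr0 scaleN1r addNr.
Qed.

(** The inductive core of the homotopy formula. Products [u j * v j] that meet inside an argument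
    are summed away by [corner_sum_mid]; [corner_eval] arises where the last pending factor leaves
    the arguments on the right. *)
Lemma corner_insert_ract m w a (f : curried A m.+1) : mlin f ->
  \sum_j corner_insert (ract f (w * a * u j)) (v j) =
  f (w * a) - ract (f w) a - corner_eval f w a + ract (corner_insert f w) a.
Proof.
elim: m f w a => [|m IH] f w a mf.
  rewrite /= sumrB -(mlin_sumE _ mf) corner_sum_mid.
  by rewrite [_ - _ - _]addrAC addrNK.
have [_ mfa] := mf; apply/funext => b.
(* The induction hypothesis is used for [f x], with [x] later set to [w * a * u j]; its first two
   terms cancel against the unfolded left side. *)
have lhs j x :
    corner_insert (ract f x) (v j) b =
    f (x * v j) b - \sum_k corner_insert (m := m) (f (x * v j * b * u k)) (v k)
    - corner_eval (m := m.+1) (f x) (v j) b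
    + ract (corner_insert (m := m) (f x) (v j)) b.
  have {}IH := IH (f x) (v j) b (mfa x).
  transitivity (f (x * v j) b - (f x (v j * b) - ract (f x (v j)) b) -
    (\sum_k corner_insert (m := m) (f (x * v j * b * u k)) (v k) -
     \sum_k corner_insert (m := m) (ract (m := m.+1) (f x) (v j * b * u k)) (v k))).
    rewrite -sumrB; congr (_ - _); apply: eq_bigr => k _.
    by rewrite -corner_insertB -!mulrA.
  rewrite IH; set D := f x _ - _; move: D => D.
  rewrite opprB -!addrA addKr; congr (_ + _); rewrite addrA [LHS]addrC; congr (_ + _).
rewrite curried_sumE (eq_bigr _ (fun j _ => lhs j _)) !big_split /= !sumrN.
have -> : \sum_j f (w * a * u j * v j) b = f (w * a) b.
  by rewrite -(curried_sumE _ _ (fun j => f (w * a * u j * v j))) -(mlin_sumE _ mf) corner_sum_mid.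
have -> : \sum_j \sum_k
    corner_insert (m := m) (f (w * a * u j * v j * b * u k)) (v k) =
    \sum_k corner_insert (m := m) (f (w * (a * b) * u k)) (v k).
  rewrite exchange_big; apply: eq_bigr => k _.
  rewrite -corner_insert_sum -(mlin_sumE _ mf) -2!mulr_suml corner_sum_mid.
  by rewrite !mulrA.
transitivity (f (w * a) b - (f w (a * b) - ract (f w a) b)
  - \sum_j corner_eval (m := m.+1) (f (w * a * u j)) (v j) b
  + (f w (a * b) - \sum_k corner_insert (m := m) (f (w * (a * b) * u k)) (v k)
     - (ract (f w a) b -
        \sum_j ract (corner_insert (m := m) (f (w * a * u j)) (v j)) b))).
  rewrite !opprB !addrA [RHS](ACl (1*6*4*7*(2*8)*(3*5)))%AC /=.
  by rewrite subrr addNr !addr0.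
congr (_ - _ + (_ - _)); first by rewrite curried_sumE.
by rewrite -ract_sum -ractB.
Qed.

Lemma corner_insert_cdiff m w a (f : curried A m.+1) : mlin f ->
  corner_insert (cdiff f) w a =
  lact w (f a) - corner_eval f w a
  - (\sum_j lact (w * a * u j) (corner_insert f (v j)) - ract (corner_insert f w) a).
Proof.
move=> mf; rewrite -[LHS]/(comm_act w f a -
  \sum_j corner_insert (m := m) (comm_act (w * a * u j) f) (v j)).
rewrite comm_actE (eq_bigr (fun j => lact (w * a * u j) (corner_insert f (v j)) -
   corner_insert (ract f (w * a * u j)) (v j))); last first.
  by move=> j _; rewrite corner_insertB corner_insert_lact.
rewrite sumrB corner_insert_ract //.
rewrite !opprD !opprK !addrA [LHS](ACl (1*7*4*8*(2*5)*(3*6)))%AC /=.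
by rewrite addNr subrr !addr0.
Qed.

(** Multiply [corner_insert_cdiff] by [u i] and sum: by [uv1] the terms in [corner_insert f] become
    [- comm_act a (corner_homotopy f)], which cancels the first summand. *)
Lemma corner_homotopyE m (f : curried A m.+1) : mlin f ->
  cdiff (corner_homotopy f) + corner_homotopy (cdiff f) = f - corner_proj f.
Proof.
move=> mf; apply/funext => a; rewrite !curriedDE curriedNE.
have -> : corner_homotopy (cdiff f) a =
    \sum_i (lact (u i * v i) (f a) - lact (u i) (corner_eval f (v i) a)
    - (\sum_j lact (u i * v i * a * u j) (corner_insert f (v j)) -
       ract (lact (u i) (corner_insert f (v i))) a)).
  apply: (etrans (curried_sumE _ _ _ _)); apply: eq_bigr => i _.
  transitivity (lact (u i) (corner_insert (cdiff f) (v i) a)); first by [].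
  rewrite corner_insert_cdiff // !lactB lactA lact_sum lract; congr (_ - (_ - _)).
  by apply: eq_bigr => j _; rewrite lactA !mulrA.
rewrite !sumrB -lact_suml uv1 lact1 exchange_big /= -ract_sum.
have -> : \sum_j \sum_i lact (u i * v i * a * u j) (corner_insert f (v j)) =
          lact a (corner_homotopy f).
  rewrite lact_sum; apply: eq_bigr => j _.
  by rewrite -lact_suml lactA -!mulr_suml uv1 mul1r.
have -> : corner_proj f a = \sum_i lact (u i) (corner_eval f (v i) a).
  exact: curried_sumE.
by rewrite -/(comm_act a _) addrC addrNK.
Qed.

(** Degree 0 is separate: there are no cochains below it, so only one of the two composites
    remains. *)
Lemma corner_homotopyE0 (f : curried A 0) :
  corner_homotopy (cdiff f) = f - corner_proj f.
Proof.
have fE : f = \sum_i u i * v i * f by rewrite -mulr_suml uv1 mul1r.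
rewrite /corner_homotopy /corner_proj [X in _ = X - _]fE -sumrB.
by apply: eq_bigr => i _; rewrite /= /cdiff /comm_act /= mulrBr mulrA.
Qed.

Lemma mlin_corner_homotopy m (f : curried A m.+1) : mlin f -> mlin (corner_homotopy f).
Proof. by move=> mf; apply: mlin_sum => i; exact/mlin_lact/mlin_corner_insert. Qed.

End Homotopy.

(** * Transfer of cochains between an algebra and a full corner *)

Section CornerTransfer.
Variables (K : fieldType) (A D : algType K) (I : finType) (i0 : I) (u v : I -> A).
Variables (iota : {linear D -> A}) (pr : {linear A -> D}).
Hypothesis uv1 : \sum_i u i * v i = 1.
Hypothesis iotaM : {morph iota : d d' / d * d'}.
Hypothesis iotaK : cancel iota pr.
Hypothesis iota_pr : forall a, iota (pr a) = iota 1 * a * iota 1.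
Hypothesis u0 : u i0 = iota 1.
Hypothesis v0 : v i0 = iota 1.
Hypothesis iota1v : forall i, iota 1 * v i = v i.
Hypothesis u_iota1 : forall i, u i * iota 1 = u i.
Hypothesis vu : forall i j, i != j -> v i * u j = 0.

Let e := iota 1.

Lemma corner_iota_inj : injective iota.
Proof. exact: can_inj iotaK. Qed.

Lemma corner_iota1l d : e * iota d = iota d.
Proof. by rewrite -iotaM mul1r. Qed.

Lemma corner_iota1r d : iota d * e = iota d.
Proof. by rewrite -iotaM mulr1. Qed.

Lemma pr_iotal d a : pr (iota d * a) = d * pr a.
Proof.
apply: corner_iota_inj; rewrite iotaM !iota_pr -/e !mulrA -[iota d * e]iotaM mulr1.
by rewrite corner_iota1l.
Qed.

Lemma pr_iotar d a : pr (a * iota d) = pr a * d.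
Proof.
apply: corner_iota_inj; rewrite iotaM !iota_pr -/e -!mulrA corner_iota1r.
by rewrite [e * iota d]corner_iota1l.
Qed.

Lemma iota_pr_corner i j a : iota (pr (v i * a * u j)) = v i * a * u j.
Proof. by rewrite iota_pr !mulrA iota1v -!mulrA u_iota1. Qed.

Fixpoint corner_restrict m : curried A m -> curried D m :=
  if m is m'.+1 then fun f d => corner_restrict (f (iota d)) else pr.

(** The counterpart of [corner_eval] for cochains on [D]. With some [v i] pending, the arguments
    [v i * a * u j] lie in the corner, so [pr] loses nothing ([iota_pr_corner]). *)
Fixpoint corner_lift m : curried D m -> A -> curried A m :=
  if m is m'.+1 then
    fun g w a => \sum_j corner_lift (g (pr (w * a * u j))) (v j)
  else fun g w => iota g * w.

Definition corner_extend m (g : curried D m) : curried A m :=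
  \sum_i lact (u i) (corner_lift g (v i)).

Lemma corner_restrict_linear m : linear (@corner_restrict m).
Proof.
elim: m => [|m IH] c f g /=; first exact: linearP.
by apply/funext => d; exact: IH.
Qed.

Lemma corner_restrictB m (f g : curried A m) :
  corner_restrict (f - g) = corner_restrict f - corner_restrict g.
Proof. by have := corner_restrict_linear (-1) g f; rewrite !scaleN1r ![- _ + _]addrC. Qed.

Lemma corner_restrict0 m : corner_restrict (0 : curried A m) = 0.
Proof. by rewrite -[X in corner_restrict X](subrr 0) corner_restrictB subrr. Qed.

Lemma corner_restrict_sum m (J : finType) (F : J -> curried A m) :
  corner_restrict (\sum_j F j) = \sum_j corner_restrict (F j).
Proof.
apply: big_morph; last exact: corner_restrict0.
by move=> f g; have := corner_restrict_linear 1 f g; rewrite !scale1r.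
Qed.

Lemma corner_restrict_lact m d (f : curried A m) :
  corner_restrict (lact (iota d) f) = lact d (corner_restrict f).
Proof.
elim: m f => [|m IH] f /=; first exact: pr_iotal.
by apply/funext => d'; exact: IH.
Qed.

Lemma corner_restrict_ract m d (f : curried A m) :
  corner_restrict (ract f (iota d)) = ract (corner_restrict f) d.
Proof.
elim: m d f => [|m IH] d f /=; first exact: pr_iotar.
by apply/funext => d'; rewrite corner_restrictB -iotaM IH.
Qed.

Lemma corner_restrict_cdiff m (f : curried A m) :
  corner_restrict (cdiff f) = cdiff (corner_restrict f).
Proof.
apply/funext => d; rewrite /cdiff /comm_act -corner_restrict_lact -corner_restrict_ract.
by rewrite -corner_restrictB.
Qed.

Lemma mlin_corner_restrict m (f : curried A m) : mlin f -> mlin (corner_restrict f).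
Proof.
elim: m f => [|m IH] f //= [lf mf]; split=> [c d d'|d]; last exact: IH.
by rewrite linearP lf corner_restrict_linear.
Qed.

Lemma corner_lift_linear m w c (f g : curried D m) :
  corner_lift (c *: f + g) w = c *: corner_lift f w + corner_lift g w.
Proof.
elim: m w f g => [|m IH] w f g /=; first by rewrite linearP mulrDl scalerAl.
apply/funext => a; rewrite curriedDE curriedZE scaler_sumr -big_split /=.
by apply: eq_bigr => j _; exact: IH.
Qed.

Lemma corner_liftB m w (f g : curried D m) :
  corner_lift (f - g) w = corner_lift f w - corner_lift g w.
Proof. by have := corner_lift_linear w (-1) g f; rewrite !scaleN1r ![- _ + _]addrC. Qed.

Lemma corner_lift0 m w : corner_lift (0 : curried D m) w = 0.
Proof. by rewrite -[X in corner_lift X](subrr 0) corner_liftB subrr. Qed.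

Lemma corner_lift_sum m w (J : finType) (F : J -> curried D m) :
  corner_lift (\sum_j F j) w = \sum_j corner_lift (F j) w.
Proof.
apply: (big_morph (fun f => corner_lift f w)); last exact: corner_lift0.
by move=> f g; have := corner_lift_linear w 1 f g; rewrite !scale1r.
Qed.

Lemma corner_extend_linear m : linear (@corner_extend m).
Proof.
move=> c f g; rewrite /corner_extend scaler_sumr -big_split; apply: eq_bigr => i _.
by rewrite corner_lift_linear lactD lactZ.
Qed.

Lemma mlin_corner_lift m w (f : curried D m) : mlin f -> mlin (corner_lift f w).
Proof.
elim: m w f => [|m IH] w f //= [lf mf]; split=> [c a b|a].
  rewrite scaler_sumr -big_split /=; apply: eq_bigr => j _.
  by rewrite mulrDr mulrDl -scalerAr -scalerAl linearP lf corner_lift_linear.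
by apply: mlin_sum => j; exact: IH.
Qed.

Lemma mlin_corner_extend m (f : curried D m) : mlin f -> mlin (corner_extend f).
Proof. by move=> mf; apply: mlin_sum => i; exact/mlin_lact/mlin_corner_lift. Qed.

Lemma corner_lift_lact m d w (g : curried D m) :
  corner_lift (lact d g) w = lact (iota d) (corner_lift g w).
Proof.
elim: m w g => [|m IH] w g /=; first by rewrite iotaM mulrA.
by apply/funext => a; rewrite lact_sum; apply: eq_bigr => j _; exact: IH.
Qed.

(** The corner elements [v i * a * u j] and [v j * b * u k] are multiplied in [D], and the sum over
    [j] contracts [u j * v j] to 1. *)
Lemma corner_lift_ract m i a (g : curried D m) : mlin g ->
  \sum_j corner_lift (ract g (pr (v i * a * u j))) (v j) =
  ract (corner_lift g (v i)) a.
Proof.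
elim: m i a g => [|m IH] i a g mg.
  rewrite /= -mulrA -[in RHS](corner_sum_mid uv1 (v i) a) mulr_sumr; apply: eq_bigr => j _.
  by rewrite iotaM iota_pr_corner !mulrA.
have [_ mga] := mg; apply/funext => b; rewrite curried_sumE.
have lhs j (x := pr (v i * a * u j)) : corner_lift (ract g x) (v j) b =
    \sum_k corner_lift (m := m) (g (pr (v i * a * u j * v j * b * u k))) (v k)
    - ract (corner_lift (m := m) (g x) (v j)) b.
  rewrite -(IH j b (g x) (mga x)) -sumrB; apply: eq_bigr => k _.
  rewrite -corner_liftB; congr (corner_lift (m := m) (g _ - _) _).
  apply: corner_iota_inj; rewrite iotaM !iota_pr_corner.
  by have := iota_pr_corner i k (a * u j * v j * b); rewrite !mulrA.
rewrite (eq_bigr _ (fun j _ => lhs j)) sumrB exchange_big /= ract_sum.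
congr (_ - _); apply: eq_bigr => k _.
rewrite -corner_lift_sum -(mlin_sumE _ mg) -linear_sum -2!mulr_suml corner_sum_mid //.
by rewrite !mulrA.
Qed.

Lemma corner_extend_cdiff m (g : curried D m) : mlin g ->
  corner_extend (cdiff g) = cdiff (corner_extend g).
Proof.
move=> mg; apply/funext => a; rewrite /cdiff /comm_act.
have -> : corner_extend (cdiff g) a = \sum_i lact (u i) (corner_lift (cdiff g) (v i) a).
  exact: curried_sumE.
transitivity (\sum_i (\sum_j lact (u i * v i * a * u j) (corner_lift g (v j))
                 - lact (u i) (ract (corner_lift g (v i)) a))).
  apply: eq_bigr => i _; rewrite -corner_lift_ract // lact_sum -sumrB /= lact_sum.
  apply: eq_bigr => j _; rewrite /cdiff /comm_act corner_liftB corner_lift_lact.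
  by rewrite iota_pr_corner lactB lactA !mulrA.
rewrite sumrB exchange_big /= lact_sum ract_sum; congr (_ - _); apply: eq_bigr => j _.
  by rewrite -lact_suml lactA -!mulr_suml uv1 mul1r.
by rewrite lract.
Qed.

(** [corner_eval] uses [f] on corner elements only, where the restriction knows its values up to a
    factor [e] on either side. The right factor is absorbed by the [v], the left one by [u i] in
    [corner_projE]. *)
Lemma corner_restrict_eval m i (f : curried A m) :
  lact e (corner_eval u v f (v i)) = corner_lift (corner_restrict f) (v i).
Proof.
elim: m i f => [|m IH] i f /=; first by rewrite iota_pr -!mulrA iota1v.
apply/funext => a; rewrite lact_sum; apply: eq_bigr => j _.
by rewrite IH iota_pr_corner.
Qed.

Lemma corner_projE m (f : curried A m) :
  corner_proj u v f = corner_extend (corner_restrict f).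
Proof.
apply: eq_bigr => i _; rewrite -corner_restrict_eval lactA.
by rewrite [u i * e]u_iota1.
Qed.

Lemma corner_restrict_lact0 m i (f : curried A m) : i != i0 ->
  corner_restrict (lact (u i) f) = 0.
Proof.
move=> ii0; elim: m f => [|m IH] f /=; last by apply/funext => d; exact: IH.
by apply: corner_iota_inj; rewrite iota_pr linear0 -v0 !mulrA vu 1?eq_sym // !mul0r.
Qed.

(** As [e = v i0], any index other than [i0] produces a factor [v i0 * u j = 0]; the single
    remaining term is [g]. *)
Lemma corner_extendK m (g : curried D m) : mlin g ->
  corner_restrict (corner_extend g) = g.
Proof.
move=> mg; rewrite /corner_extend corner_restrict_sum (bigD1 i0) //= big1 ?addr0.
  rewrite u0 corner_restrict_lact lact1 v0.
  elim: m g mg => [|m IH] g mg /=; first by rewrite [iota g * _]corner_iota1r iotaK.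
  have [lg mga] := mg; apply/funext => d.
  rewrite corner_restrict_sum (bigD1 i0) //= big1 ?addr0.
    by rewrite u0 v0 [iota 1 * iota d]corner_iota1l [iota d * _]corner_iota1r iotaK (IH _ (mga d)).
  move=> j j0; have -> : iota 1 * iota d * u j = 0.
    by rewrite [iota 1 * _]corner_iota1l -[iota d]corner_iota1r -[e]v0 -mulrA vu ?mulr0 // eq_sym.
  have -> : g (pr 0) = 0.
    by have := lg (-1) 0 0; rewrite linear0 scaler0 addr0 scaleN1r addNr.
  by rewrite corner_lift0 corner_restrict0.
by move=> i ii0; exact: corner_restrict_lact0.
Qed.

End CornerTransfer.

(** * Hochschild cohomology in curried form *)

Section QuotientMap.
Variables (K : pzRingType) (V W : lmodType K).
Variables (S : submodClosed V) (T : submodClosed W) (f : {linear V -> W}).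
Hypothesis fST : {in S, forall v, f v \in T}.

Lemma lmod_pi_eqP (U : lmodType K) (Z : submodClosed U) (a b : U) :
  (lmod_pi Z a = lmod_pi Z b) <-> (a - b \in Z).
Proof. by rewrite -eq_lmod_quot; split=> /eqP. Qed.

Lemma lmod_pi_repr (U : lmodType K) (Z : submodClosed U) (x : lmod_quot Z) :
  lmod_pi Z (repr x) = x.
Proof. exact: reprK. Qed.

Definition quot_map (x : lmod_quot S) : lmod_quot T := lmod_pi T (f (repr x)).

Lemma quot_map_pi v : quot_map (lmod_pi S v) = lmod_pi T (f v).
Proof.
apply/lmod_pi_eqP; rewrite -linearB; apply: fST.
by apply/lmod_pi_eqP; rewrite lmod_pi_repr.
Qed.

Fact quot_map_is_linear : linear quot_map.
Proof.
move=> c x y; rewrite -[x]lmod_pi_repr -[y]lmod_pi_repr -linearP !quot_map_pi.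
by rewrite !linearP.
Qed.

HB.instance Definition _ :=
  GRing.isLinear.Build K (lmod_quot S) (lmod_quot T) *:%R quot_map quot_map_is_linear.

Definition quot_linear : {linear lmod_quot S -> lmod_quot T} := quot_map.

End QuotientMap.

Lemma quot_linear_bij (K : pzRingType) (V W : lmodType K)
    (S : submodClosed V) (T : submodClosed W)
    (f : {linear V -> W}) (g : {linear W -> V})
    (fST : {in S, forall v, f v \in T}) (gTS : {in T, forall w, g w \in S}) :
  (forall v, v - g (f v) \in S) -> (forall w, w - f (g w) \in T) ->
  bijective (quot_linear fST).
Proof.
move=> gf fg; exists (quot_linear gTS) => x; rewrite -[x]lmod_pi_repr /=.
  by rewrite !quot_map_pi //; apply/esym/lmod_pi_eqP.
by rewrite !quot_map_pi //; apply/esym/lmod_pi_eqP.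
Qed.

(** * Currying and the Hochschild differential *)

Section Currying.
Variables (K : fieldType) (A : algType K).

Definition fcons (T : Type) m (x : T) (a : 'I_m -> T) (i : 'I_m.+1) : T :=
  if unlift ord0 i is Some j then a j else x.

Lemma fcons0 T m (x : T) (a : 'I_m -> T) : fcons x a ord0 = x.
Proof. by rewrite /fcons unlift_none. Qed.

Lemma fconsS T m (x : T) (a : 'I_m -> T) j : fcons x a (lift ord0 j) = a j.
Proof. by rewrite /fcons liftK. Qed.

Lemma fcons_lift T m (x : T) (a : 'I_m -> T) : fcons x a \o lift ord0 = a.
Proof. by apply/funext => j; exact: fconsS. Qed.

Lemma fconsK T m (a : 'I_m.+1 -> T) : fcons (a ord0) (a \o lift ord0) = a.
Proof.
by apply/funext => i; case: (unliftP ord0 i) => [j ->|->]; rewrite (fconsS, fcons0).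
Qed.

Fixpoint uncurry_cochain m : curried A m -> ('I_m -> A) -> A :=
  if m is m'.+1 then fun f a => uncurry_cochain (f (a ord0)) (a \o lift ord0)
  else fun f _ => f.

(** In degree 0, [fun=> 0] stands for the unique function on the empty type ['I_0]. *)
Fixpoint curry_cochain m : (('I_m -> A) -> A) -> curried A m :=
  if m is m'.+1 then fun F x => curry_cochain (fun a => F (fcons x a))
  else fun F => F (fun=> 0).

Lemma curry_cochainK m : cancel (@curry_cochain m) (@uncurry_cochain m).
Proof.
elim: m => [|m IH] F; apply/funext => a /=.
  by congr F; apply/funext => -[].
by rewrite IH fconsK.
Qed.

Lemma uncurry_cochainK m : cancel (@uncurry_cochain m) (@curry_cochain m).
Proof.
elim: m => [|m IH] f //=; apply/funext => x; rewrite -[RHS]IH; congr curry_cochain.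
by apply/funext => a; rewrite fcons0 fcons_lift.
Qed.

Lemma uncurry_cochain_linear m : linear (@uncurry_cochain m).
Proof.
elim: m => [|m IH] c f g; apply/funext => a //=.
by rewrite IH.
Qed.

Lemma dfwith_eq (m : nat) (a : 'I_m -> A) i x j :
  @dfwith _ (fun=> A) a i x j = if j == i then x else a j.
Proof.
by case: eqVneq => [->|ji]; [rewrite dfwith_in|rewrite dfwith_out // eq_sym].
Qed.

Lemma fcons_dfwith0 m x y (a : 'I_m -> A) :
  @dfwith _ (fun=> A) (fcons y a) ord0 x = fcons x a.
Proof.
apply/funext => j; rewrite dfwith_eq.
case: (unliftP ord0 j) => [i ->|->]; last by rewrite eqxx fcons0.
by rewrite -val_eqE /= !fconsS.
Qed.

Lemma fcons_dfwithS m x y (a : 'I_m -> A) i :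
  @dfwith _ (fun=> A) (fcons y a) (lift ord0 i) x =
  fcons y (@dfwith _ (fun=> A) a i x).
Proof.
apply/funext => j; rewrite dfwith_eq.
case: (unliftP ord0 j) => [i' ->|->]; last by rewrite fcons0 -val_eqE /= fcons0.
by rewrite !fconsS dfwith_eq (inj_eq lift_inj).
Qed.

Lemma uncurry_multilinear m (f : curried A m) : mlin f ->
  uncurry_cochain f \in @multilinear K A m.
Proof.
move=> mf; apply/asboolP; elim: m f mf => [|m IH] f mf a i; first by case: i.
have [lf mfa] := mf; rewrite -[a]fconsK.
case: (unliftP ord0 i) => [j ->|->] c x y /=.
  by rewrite !fcons_dfwithS !fcons0 !fcons_lift; exact: (IH _ (mfa _)).
by rewrite !fcons_dfwith0 !fcons0 !fcons_lift lf uncurry_cochain_linear.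
Qed.

Lemma curry_mlin m (F : ('I_m -> A) -> A) : F \in @multilinear K A m ->
  mlin (curry_cochain F).
Proof.
move=> /asboolP; elim: m F => [|m IH] F mF //; split=> [c x y|x].
  apply: (can_inj (@uncurry_cochainK m)); rewrite uncurry_cochain_linear !curry_cochainK.
  apply/funext => a.
  have := mF (fcons 0 a) ord0 c x y; rewrite !fcons_dfwith0.
  by [].
apply: IH => a i c y z; have := mF (fcons x a) (lift ord0 i) c y z.
by rewrite !fcons_dfwithS.
Qed.

(** Beyond the first two terms, every summand acts behind [x] and is, up to the sign of the shift, a
    summand of the differential of [F (fcons x _)]. The term [y * F (fcons x a)] compensates the
    leading summand of that differential. The result is the recursion of [comm_actE]. *)
Lemma hoch_fun_fcons m (F : ('I_m.+1 -> A) -> A) x y (a : 'I_m -> A) :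
  hoch_fun F (fcons x (fcons y a)) =
  x * F (fcons y a) - F (fcons (x * y) a) + y * F (fcons x a)
  - hoch_fun (fun b => F (fcons x b)) (fcons y a).
Proof.
rewrite /hoch_fun big_ord_recl /= fcons0 !fcons_lift.
have -> : contract ord0 (fcons x (fcons y a)) = fcons (x * y) a.
  apply/funext => j; rewrite /contract ltn0; case: (unliftP ord0 j) => [i ->|->].
    by rewrite -val_eqE /= !fconsS.
  have -> : widen_ord (leqnSn m.+1) ord0 = ord0 by exact/val_inj.
  by rewrite eqxx fconsS !fcons0.
have E (i : 'I_m) : contract (lift ord0 i) (fcons x (fcons y a)) =
    fcons x (contract i (fcons y a)).
  apply/funext => j; case: (unliftP ord0 j) => [j' ->|->].
    rewrite fconsS /contract -!val_eqE /= /bump /= !add1n ltnS eqSS !fconsS.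
    case: ifP => _; last case: ifP => _ //.
      rewrite -(fconsS x (fcons y a)); congr (fcons _ _ _); exact/val_inj.
    rewrite -(fconsS x (fcons y a)); congr (fcons _ _ _ * _); exact/val_inj.
  rewrite /contract /= fcons0 -[RHS](fcons0 x (fcons y a)).
  by congr (fcons _ _ _); exact/val_inj.
have -> : fcons x (fcons y a) \o widen_ord (leqnSn m.+1) =
    fcons x (fcons y a \o widen_ord (leqnSn m)).
  apply/funext => j; case: (unliftP ord0 j) => [j' ->|->] /=.
    by rewrite fconsS /= -(fconsS x (fcons y a)); congr (fcons _ _ _); exact/val_inj.
  by rewrite fcons0 -[RHS](fcons0 x (fcons y a)); congr (fcons _ _ _); exact/val_inj.
have -> : fcons x (fcons y a) ord_max = fcons y a ord_max.
  by rewrite -(fconsS x (fcons y a)); congr (fcons _ _ _); exact/val_inj.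
rewrite (eq_bigr _ (fun i _ => congr1 _ (congr1 _ (E i)))).
rewrite fcons0 expr1 mulN1r [(-1) ^+ m.+2]exprS mulN1r mulNr.
rewrite (eq_bigr (fun i : 'I_m => - ((-1) ^+ i.+1 * F (fcons x (contract i (fcons y a)))))).
  by rewrite sumrN !opprD !addrA addrK.
by move=> i _; rewrite E /bump add1n exprS mulN1r mulNr.
Qed.

Lemma uncurry_fcons m (f : curried A m.+1) x a :
  uncurry_cochain f (fcons x a) = uncurry_cochain (f x) a.
Proof. by rewrite /= fcons0 fcons_lift. Qed.

Lemma uncurry_lact m x (f : curried A m) a :
  uncurry_cochain (lact x f) a = x * uncurry_cochain f a.
Proof. by elim: m f a => [|m IH] f a //=. Qed.

Lemma uncurryD m (f g : curried A m) a :
  uncurry_cochain (f + g) a = uncurry_cochain f a + uncurry_cochain g a.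
Proof. by have := uncurry_cochain_linear 1 f g; rewrite !scale1r => ->. Qed.

Lemma uncurryB m (f g : curried A m) a :
  uncurry_cochain (f - g) a = uncurry_cochain f a - uncurry_cochain g a.
Proof.
have := uncurry_cochain_linear (-1) g f; rewrite !scaleN1r ![- _ + _]addrC => ->.
by [].
Qed.


Lemma uncurry_cdiff m (f : curried A m) :
  uncurry_cochain (cdiff f) = hoch_fun (uncurry_cochain f).
Proof.
elim: m f => [|m IH] f; apply/funext => a.
  rewrite /hoch_fun /= big_ord0 addr0 expr1 mulN1r.
  by congr (_ * _ - _ * a _); exact/val_inj.
rewrite -[a]fconsK -[a \o lift ord0]fconsK.
move: {a}(a ord0) ((a \o lift ord0) ord0) ((a \o lift ord0) \o lift ord0) => x y b.
rewrite hoch_fun_fcons [in LHS]uncurry_fcons [in LHS]uncurry_fcons /cdiff comm_actE.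
rewrite uncurryD uncurryB uncurry_lact !uncurry_fcons.
have -> : (fun b0 => uncurry_cochain f (fcons x b0)) = uncurry_cochain (f x).
  by apply/funext => b0; rewrite uncurry_fcons.
rewrite -IH uncurry_fcons /cdiff /comm_act uncurryB uncurry_lact.
by rewrite opprB [_ - y * _]addrC addrA addrK.
Qed.

End Currying.

(** * Cochains, cocycles and coboundaries in curried form *)

Section CochainCurry.
Variables (K : fieldType) (A : algType K).

Definition curry l (F : cochain A l) : curried A l := curry_cochain F.

Lemma mlin_curry l (F : cochain A l) : mlin (curry F).
Proof. exact/curry_mlin/valP. Qed.

Lemma curry_inj l : injective (@curry l).
Proof. by move=> F G /(can_inj (@curry_cochainK _ _ _)) /val_inj. Qed.

Lemma curry_linear l : linear (@curry l).
Proof.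
move=> c F G; apply: (can_inj (@uncurry_cochainK _ _ _)).
by rewrite uncurry_cochain_linear !curry_cochainK.
Qed.

Lemma curryB l (F G : cochain A l) : curry (F - G) = curry F - curry G.
Proof. by have := curry_linear (-1) G F; rewrite !scaleN1r ![- _ + _]addrC. Qed.

Lemma curry0 l : curry (0 : cochain A l) = 0.
Proof. by rewrite -[X in curry X](subrr 0) curryB subrr. Qed.

Lemma curry_hoch_diff l (F : cochain A l) : curry (hoch_diff F) = cdiff (curry F).
Proof.
by apply: (can_inj (@uncurry_cochainK _ _ _)); rewrite uncurry_cdiff !curry_cochainK.
Qed.

Definition uncurry l (f : curried A l) (mf : mlin f) : cochain A l :=
  Cochain (uncurry_multilinear mf).

Lemma uncurryK l (f : curried A l) (mf : mlin f) : curry (uncurry mf) = f.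
Proof. exact: uncurry_cochainK. Qed.

Lemma coboundaryP0 (z : cocycle A 0) : curry z = 0 -> z \in @coboundary K A 0.
Proof.
move=> z0; rewrite unfold_in; apply/eqP/curry_inj; rewrite z0.
by rewrite curry0.
Qed.

Lemma coboundaryPS l (z : cocycle A l.+1) (f : curried A l) :
  mlin f -> curry z = cdiff f -> z \in @coboundary K A l.+1.
Proof.
move=> mf zf; rewrite unfold_in; apply/asboolP; exists (uncurry mf).
by apply: curry_inj; rewrite curry_hoch_diff uncurryK.
Qed.

Lemma cdiff_cocycle l (z : cocycle A l) : cdiff (curry z) = 0.
Proof.
have /eqP dz : hoch_diff z == 0 := valP z.
by rewrite -curry_hoch_diff dz curry0.
Qed.

End CochainCurry.

(** * Maps of cocycles induced by cochain maps *)

Section CocycleMap.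
Variables (K : fieldType) (A D : algType K).
Variable r : forall l, curried A l -> curried D l.
Hypothesis r_linear : forall l, linear (@r l).
Hypothesis mlin_r : forall l (f : curried A l), mlin f -> mlin (r f).
Hypothesis r_cdiff : forall l (f : curried A l), mlin f -> r (cdiff f) = cdiff (r f).

Definition cochain_map l (F : cochain A l) : cochain D l :=
  uncurry (mlin_r (mlin_curry F)).

Lemma curry_cochain_map l (F : cochain A l) : curry (cochain_map F) = r (curry F).
Proof. exact: uncurryK. Qed.

Fact cochain_map_is_linear l : linear (@cochain_map l).
Proof.
move=> c F G; apply: curry_inj; rewrite curry_cochain_map !curry_linear r_linear.
by rewrite !curry_cochain_map.
Qed.

Lemma hoch_diff_cochain_map l (F : cochain A l) :
  hoch_diff (cochain_map F) = cochain_map (hoch_diff F).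
Proof.
apply: curry_inj; rewrite curry_hoch_diff !curry_cochain_map curry_hoch_diff.
by rewrite r_cdiff //; exact: mlin_curry.
Qed.

Lemma cochain_map0 l : cochain_map (0 : cochain A l) = 0.
Proof.
have := cochain_map_is_linear (-1) (0 : cochain A l) 0.
by rewrite !scaleN1r !addNr.
Qed.

Fact cochain_map_cocycle l (z : cocycle A l) :
  cochain_map z \in @cocycle_pred K D l.
Proof.
case: z => z /=; rewrite !unfold_in hoch_diff_cochain_map => /eqP ->.
by rewrite cochain_map0.
Qed.

Definition cocycle_map l (z : cocycle A l) : cocycle D l :=
  Cocycle (cochain_map_cocycle z).

Lemma curry_cocycle_map l (z : cocycle A l) : curry (cocycle_map z) = r (curry z).
Proof. exact: curry_cochain_map. Qed.

Fact cocycle_map_is_linear l : linear (@cocycle_map l).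
Proof. by move=> c z w; apply/val_inj; exact: cochain_map_is_linear. Qed.

HB.instance Definition _ l :=
  GRing.isLinear.Build K (cocycle A l) (cocycle D l) *:%R (@cocycle_map l)
    (@cocycle_map_is_linear l).

Lemma cocycle_map_coboundary l :
  {in @coboundary K A l, forall z, cocycle_map z \in @coboundary K D l}.
Proof.
case: l => [|l] z; rewrite !unfold_in /=.
  by move=> /eqP ->; rewrite cochain_map0.
move=> /asboolP[F zF]; apply/asboolP; exists (cochain_map F).
by rewrite hoch_diff_cochain_map -zF.
Qed.

End CocycleMap.

(** * Cohomology of a full corner *)

Section CornerCohomology.
Variables (K : fieldType) (A D : algType K) (I : finType) (i0 : I) (u v : I -> A).
Variables (iota : {linear D -> A}) (pr : {linear A -> D}).
Hypothesis uv1 : \sum_i u i * v i = 1.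
Hypothesis iotaM : {morph iota : d d' / d * d'}.
Hypothesis iotaK : cancel iota pr.
Hypothesis iota_pr : forall a, iota (pr a) = iota 1 * a * iota 1.
Hypothesis u0 : u i0 = iota 1.
Hypothesis v0 : v i0 = iota 1.
Hypothesis iota1v : forall i, iota 1 * v i = v i.
Hypothesis u_iota1 : forall i, u i * iota 1 = u i.
Hypothesis vu : forall i j, i != j -> v i * u j = 0.

(** On a cocycle the homotopy formula leaves only the differential of [corner_homotopy]; in degree 0
    that term is absent and the difference is zero. *)
Lemma corner_coboundary l (z z' : cocycle A l) :
  curry z' = curry z - corner_proj u v (curry z) -> z' \in @coboundary K A l.
Proof.
have h0 p : corner_homotopy u v (0 : curried A p.+1) = 0.
  by apply: big1 => i _; rewrite corner_insert0 lact0.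
have := cdiff_cocycle z; case: l z z' => [|l] z z' dz zE.
  by apply: coboundaryP0; rewrite zE -(corner_homotopyE0 uv1) dz h0.
apply: (@coboundaryPS _ _ _ _ (corner_homotopy u v (curry z))).
  exact/mlin_corner_homotopy/mlin_curry.
by rewrite zE -(corner_homotopyE uv1 (mlin_curry z)) dz h0 addr0.
Qed.

(** Restriction after extension is the identity on the cocycles themselves; extension after
    restriction is [corner_proj], which changes a cocycle by a coboundary. *)
Theorem corner_hoch_cohom l :
  exists phi : {linear hoch_cohom A l -> hoch_cohom D l}, bijective phi.
Proof.
pose rho := @cocycle_map K A D (@corner_restrict K A D iota pr)
  (@corner_restrict_linear K A D iota pr)
  (@mlin_corner_restrict K A D iota pr)
  (fun l f _ => corner_restrict_cdiff iotaM iotaK iota_pr f) l.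
have rhoS : {in @coboundary K A l, forall z, rho z \in @coboundary K D l}.
  exact: cocycle_map_coboundary.
pose sigma := @cocycle_map K D A (@corner_extend K A D I u v iota pr)
  (@corner_extend_linear K A D I u v iota pr)
  (@mlin_corner_extend K A D I u v iota pr)
  (@corner_extend_cdiff K A D I u v iota pr uv1 iotaM iotaK iota_pr iota1v u_iota1) l.
have sigmaS : {in @coboundary K D l, forall z, sigma z \in @coboundary K A l}.
  exact: cocycle_map_coboundary.
exists (quot_linear rhoS); apply: (@quot_linear_bij _ _ _ _ _ _ sigma rhoS sigmaS).
  move=> z; apply: (@corner_coboundary _ z).
  by rewrite curryB !curry_cocycle_map (corner_projE iota_pr iota1v u_iota1).
move=> w; apply/lmod_pi_eqP; congr (lmod_pi _ _).
apply/val_inj/curry_inj; rewrite !curry_cocycle_map.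
by rewrite (corner_extendK iotaM iotaK iota_pr u0 v0 vu (mlin_curry w)).
Qed.

End CornerCohomology.

(** * Clifford-Weyl algebras *)

Section FreeAlgebraHom.
Variables (K : comNzRingType) (G : choiceType) (T : nzRingType).
Variables (s : {rmorphism K -> T}) (g : G -> T).
Hypothesis s_central : forall c x, s c * x = x * s c.

Definition fmonom_eval (m : {fmonom G}) : T := \prod_(x <- (m : seq G)) g x.

Definition free_alg_hom (a : free_alg K G) : T := mmap s fmonom_eval a.

Lemma free_alg_homD a b : free_alg_hom (a + b) = free_alg_hom a + free_alg_hom b.
Proof. exact: mmapD. Qed.

Lemma free_alg_homN a : free_alg_hom (- a) = - free_alg_hom a.
Proof. exact: mmapN. Qed.

Lemma free_alg_hom0 : free_alg_hom 0 = 0.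
Proof. exact: mmap0. Qed.

Lemma free_alg_homZ c a : free_alg_hom (c *: a) = s c * free_alg_hom a.
Proof.
rewrite /free_alg_hom (mmapEw (msuppZ_le _ _)) mmapE big_distrr /=.
by apply: eq_bigr => m _; rewrite linearZ rmorphM /= mulrA.
Qed.

Lemma fmonom_evalM m m' : fmonom_eval (mmul m m') = fmonom_eval m * fmonom_eval m'.
Proof. by rewrite /fmonom_eval fmM big_cat. Qed.

Lemma free_alg_homM a b : free_alg_hom (a * b) = free_alg_hom a * free_alg_hom b.
Proof.
rewrite /free_alg_hom malgME raddf_sum mulr_suml /=; apply: eq_bigr => i _.
rewrite raddf_sum mulr_sumr /=; apply: eq_bigr => j _.
by rewrite mmapU /= rmorphM fmonom_evalM -mulrA [X in _ * X = _]mulrA [X in _ * (X * _) = _]s_central !mulrA.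
Qed.

Lemma free_alg_hom_nat p : free_alg_hom p%:R = p%:R.
Proof.
rewrite -mpolyC_nat /free_alg_hom mmapU /= rmorph_nat /fmonom_eval fm1 big_nil.
by rewrite mulr1.
Qed.

Lemma free_alg_hom_gen x : free_alg_hom (free_gen K x) = g x.
Proof.
by rewrite /free_alg_hom mmapU /= rmorph1 mul1r /fmonom_eval fmU big_seq1.
Qed.

Lemma free_alg_hom_gen2 x y :
  free_alg_hom (free_gen K x * free_gen K y) = g x * g y.
Proof. by rewrite free_alg_homM !free_alg_hom_gen. Qed.

Lemma free_alg_hom_anticomm x y :
  free_alg_hom (free_gen K x * free_gen K y + free_gen K y * free_gen K x) =
  g x * g y + g y * g x.
Proof.
apply: etrans (free_alg_homD _ _) _.
by congr (_ + _); exact: free_alg_hom_gen2.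
Qed.

Lemma free_alg_hom_comm x y :
  free_alg_hom (free_gen K x * free_gen K y - free_gen K y * free_gen K x) =
  g x * g y - g y * g x.
Proof.
apply: etrans (free_alg_homD _ _) _; congr (_ + _).
  exact: free_alg_hom_gen2.
by rewrite free_alg_homN; congr (- _); exact: free_alg_hom_gen2.
Qed.

Lemma free_alg_hom_subn a p : free_alg_hom (a - p%:R) = free_alg_hom a - p%:R.
Proof. by rewrite free_alg_homD free_alg_homN free_alg_hom_nat. Qed.

End FreeAlgebraHom.

(** * Universal property and induction principle *)

Section CliffordWeylUniversal.
Variables (K : comNzRingType) (n k : nat).

Definition cw_gen (x : cw_index n k) : clifford_weyl K n k :=
  alg_pi (cw_ideal K n k) (free_gen K x).

Definition cw_relations (T : nzRingType) (g : cw_index n k -> T) : Prop :=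
  [/\ forall i j, g (inl i) * g (inl j) + g (inl j) * g (inl i) = 2 * (i == j)%:R,
      forall i j, g (inr (inl i)) * g (inr (inr j)) - g (inr (inr j)) * g (inr (inl i))
                  = (i == j)%:R,
      forall i j, g (inr (inl i)) * g (inr (inl j)) = g (inr (inl j)) * g (inr (inl i)),
      forall i j, g (inr (inr i)) * g (inr (inr j)) = g (inr (inr j)) * g (inr (inr i)) &
      forall i x, g (inl i) * g (inr x) + g (inr x) * g (inl i) = 0].

Lemma cw_pi_relator r : cw_relator r -> alg_pi (cw_ideal K n k) r = 0.
Proof.
move=> rr; rewrite -(raddf0 (alg_pi (cw_ideal K n k))); apply/lmod_pi_eqP.
rewrite subr0; apply/asboolP; rewrite -[r]addr0 -[r]mul1r -[1 * r]mulr1.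
by apply: ideal_span_add => //; exact: ideal_span_0.
Qed.

Lemma cw_piD a b : alg_pi (cw_ideal K n k) (a + b) =
  alg_pi (cw_ideal K n k) a + alg_pi (cw_ideal K n k) b.
Proof. exact: rmorphD. Qed.

Lemma cw_piB a b : alg_pi (cw_ideal K n k) (a - b) =
  alg_pi (cw_ideal K n k) a - alg_pi (cw_ideal K n k) b.
Proof. exact: rmorphB. Qed.

Lemma cw_piM a b : alg_pi (cw_ideal K n k) (a * b) =
  alg_pi (cw_ideal K n k) a * alg_pi (cw_ideal K n k) b.
Proof. exact: rmorphM. Qed.

Lemma cw_pi_nat p : alg_pi (cw_ideal K n k) p%:R = p%:R.
Proof. exact: rmorph_nat. Qed.

Lemma cw_gen_relations : cw_relations cw_gen.
Proof.
split=> [i j|i j|i j|i j|i [] j].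
- apply/eqP; rewrite -subr_eq0 -natrM -cw_pi_nat natrM -!cw_piM -cw_piD -cw_piB.
  exact/eqP/cw_pi_relator/cw_rel_ww.
- apply/eqP; rewrite -subr_eq0 -cw_pi_nat -!cw_piM -!cw_piB.
  exact/eqP/cw_pi_relator/cw_rel_pq.
- apply/eqP; rewrite -subr_eq0 -!cw_piM -cw_piB.
  exact/eqP/cw_pi_relator/cw_rel_pp.
- apply/eqP; rewrite -subr_eq0 -!cw_piM -cw_piB.
  exact/eqP/cw_pi_relator/cw_rel_qq.
- by rewrite -!cw_piM -cw_piD; exact/cw_pi_relator/cw_rel_wp.
- by rewrite -!cw_piM -cw_piD; exact/cw_pi_relator/cw_rel_wq.
Qed.

(** Monomials are words, obtained from 1 by left multiplication with generators, and they span the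
    free algebra. *)
Lemma cw_gen_ind (S : clifford_weyl K n k -> Prop) : S 1 ->
  (forall c a b, S a -> S b -> S (c *: a + b)) ->
  (forall x a, S a -> S (cw_gen x * a)) -> forall a, S a.
Proof.
move=> S1 SD Sgen a; rewrite -[a]alg_piK.
have S0 : S 0 by have := SD (-1) _ _ S1 S1; rewrite scaleN1r addNr.
have monE c (m : {fmonom cw_index n k}) :
    (mkmalgU m c : free_alg K (cw_index n k)) = c *: mkmalgU m 1.
  by rewrite -mul_malgC malgM_def fgmulUU mulr1 mul1m.
have SU (m : {fmonom cw_index n k}) : S (alg_pi (cw_ideal K n k) (mkmalgU m 1)).
  rewrite -[m]fmK; elim: (m : seq _) => [|x l IH].
    have -> : FMonom [::] = mone :> {fmonom cw_index n k} by apply/eqP; rewrite fmP fm1.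
    by rewrite [alg_pi _ _](cw_pi_nat 1).
  have -> : FMonom (x :: l) = mmul (fmu x) (FMonom l) by apply/eqP; rewrite fmP fmM fmU.
  have -> : (mkmalgU (mmul (fmu x) (FMonom l)) 1 : free_alg K (cw_index n k)) =
      free_gen K x * mkmalgU (FMonom l) 1.
    apply/esym/(etrans (malgM_def (mkmalgU (fmu x) 1) (mkmalgU (FMonom l) 1))).
    by rewrite fgmulUU mulr1.
  by rewrite cw_piM; exact: Sgen.
rewrite [repr a]monalgE raddf_sum /=.
elim/big_rec: _ => // m x _ Sx; rewrite monE linearZ /=; exact: SD.
Qed.

Section Hom.
Variables (T : nzRingType) (s : {rmorphism K -> T}) (g : cw_index n k -> T).
Hypothesis s_central : forall c x, s c * x = x * s c.
Hypothesis gR : cw_relations g.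

Lemma free_alg_hom_ideal a : a \in cw_ideal K n k -> free_alg_hom s g a = 0.
Proof.
move=> /asboolP; elim=> [|b r c y rr _ IH]; first exact: free_alg_hom0.
rewrite free_alg_homD IH addr0 !free_alg_homM //.
suff -> : free_alg_hom s g r = 0 by rewrite mulr0 mul0r.
have [ww pq pp qq wx] := gR.
case: rr => i j; rewrite /cw_omega /cw_p /cw_q.
- rewrite -natrM; apply: etrans (free_alg_hom_subn _ _ _ _) _.
  by rewrite natrM -ww; apply/eqP; rewrite subr_eq0; apply/eqP/free_alg_hom_anticomm.
- apply: etrans (free_alg_hom_subn _ _ _ _) _.
  by rewrite -pq; apply/eqP; rewrite subr_eq0; apply/eqP/free_alg_hom_comm.
- by apply: etrans (free_alg_hom_comm _ _ _ _) _; rewrite // pp subrr.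
- by apply: etrans (free_alg_hom_comm _ _ _ _) _; rewrite // qq subrr.
- by apply: etrans (free_alg_hom_anticomm _ _ _ _) _.
- by apply: etrans (free_alg_hom_anticomm _ _ _ _) _.
Qed.

Definition cw_hom (x : clifford_weyl K n k) : T := free_alg_hom s g (repr x).

Lemma cw_hom_pi a : cw_hom (alg_pi (cw_ideal K n k) a) = free_alg_hom s g a.
Proof.
apply/eqP; rewrite -subr_eq0 -free_alg_homN -free_alg_homD free_alg_hom_ideal //.
by apply/lmod_pi_eqP; exact: alg_piK.
Qed.

Lemma cw_homD x y : cw_hom (x + y) = cw_hom x + cw_hom y.
Proof. by rewrite -[x]alg_piK -[y]alg_piK -raddfD !cw_hom_pi free_alg_homD. Qed.

Lemma cw_homM x y : cw_hom (x * y) = cw_hom x * cw_hom y.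
Proof. by rewrite -[x]alg_piK -[y]alg_piK -rmorphM !cw_hom_pi free_alg_homM. Qed.

Lemma cw_homZ c x : cw_hom (c *: x) = s c * cw_hom x.
Proof. by rewrite -[x]alg_piK -linearZ !cw_hom_pi free_alg_homZ. Qed.

Lemma cw_hom1 : cw_hom 1 = 1.
Proof.
rewrite -(rmorph1 (alg_pi (cw_ideal K n k))) cw_hom_pi.
exact: (free_alg_hom_nat _ _ 1).
Qed.

Lemma cw_hom_gen x : cw_hom (cw_gen x) = g x.
Proof. by rewrite cw_hom_pi free_alg_hom_gen. Qed.

End Hom.
End CliffordWeylUniversal.

(** * Two-by-two matrices *)

Section Matrix2.
Variable D : nzRingType.

Definition mx2 (a b c d : D) : 'M[D]_2 :=
  \matrix_(i, j) if i == 0 then (if j == 0 then a else b)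
                 else (if j == 0 then c else d).

Lemma mx2_ext (M N : 'M[D]_2) : M 0 0 = N 0 0 -> M 0 1 = N 0 1 ->
  M 1 0 = N 1 0 -> M 1 1 = N 1 1 -> M = N.
Proof.
move=> h00 h01 h10 h11; apply/matrixP => i j.
have I2 (r : 'I_2) : r = 0 \/ r = 1.
  by case: r => [[|[|//]] ri]; [left|right]; exact/val_inj.
by case: (I2 i) => ->; case: (I2 j) => ->.
Qed.

Lemma mx2M a b c d a' b' c' d' : mx2 a b c d * mx2 a' b' c' d' =
  mx2 (a * a' + b * c') (a * b' + b * d') (c * a' + d * c') (c * b' + d * d').
Proof. by apply: mx2_ext; rewrite !mxE !big_ord_recl big_ord0 !mxE /= addr0. Qed.

Lemma mx2D a b c d a' b' c' d' : mx2 a b c d + mx2 a' b' c' d' =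
  mx2 (a + a') (b + b') (c + c') (d + d').
Proof. by apply: mx2_ext; rewrite !mxE. Qed.

Lemma mx2N a b c d : - mx2 a b c d = mx2 (- a) (- b) (- c) (- d).
Proof. by apply: mx2_ext; rewrite !mxE. Qed.

Lemma scalar_mxME a (M : 'M[D]_2) i j : (a%:M * M) i j = a * M i j.
Proof. by rewrite -[a%:M * M]/(a%:M *m M) mul_scalar_mx mxE. Qed.

Lemma scalar_mx_central a (M : 'M[D]_2) : (forall b, a * b = b * a) ->
  a%:M * M = M * a%:M.
Proof.
move=> aC; apply/matrixP => i j; rewrite scalar_mxME mxE (bigD1 j) //=.
rewrite big1 => [|l lj]; first by rewrite addr0 mxE eqxx aC.
by rewrite mxE (negPf lj) mulr0.
Qed.

Lemma scalar_mx2 a : a%:M = mx2 a 0 0 a.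
Proof. by apply: mx2_ext; rewrite !mxE. Qed.

Lemma mx2_0 : mx2 0 0 0 0 = 0.
Proof. by apply: mx2_ext; rewrite !mxE. Qed.

Lemma mx2_nat n : n%:R = mx2 n%:R 0 0 n%:R.
Proof. by rewrite -scalar_mx2 -[LHS](rmorph_nat (@scalar_mx D 2)). Qed.

End Matrix2.

(** * Splitting off the first two Clifford generators *)

Section EmbedPair.
Variables (n k : nat).

Definition cw_embed (x : cw_index n k) : cw_index n.+2 k :=
  match x with
  | inl i => inl (lift ord0 (lift ord0 i))
  | inr y => inr y
  end.

Definition cw_first : cw_index n.+2 k := inl ord0.
Definition cw_second : cw_index n.+2 k := inl (lift ord0 ord0).

Lemma cw_indexP (P : cw_index n.+2 k -> Prop) : P cw_first -> P cw_second ->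
  (forall x, P (cw_embed x)) -> forall x, P x.
Proof.
move=> P0 P1 PE [i|y]; last exact: (PE (inr y)).
case: (unliftP ord0 i) => [j ->|->] //; case: (unliftP ord0 j) => [l ->|->] //.
exact: (PE (inl l)).
Qed.

Definition cw_extend (T : Type) (w0 w1 : T) (g : cw_index n k -> T)
    (x : cw_index n.+2 k) : T :=
  match x with
  | inl i => if unlift ord0 i is Some j then
               (if unlift ord0 j is Some l then g (inl l) else w1) else w0
  | inr y => g (inr y)
  end.

Lemma cw_extend_first T (w0 w1 : T) g : cw_extend w0 w1 g cw_first = w0.
Proof. by rewrite /cw_extend /= unlift_none. Qed.

Lemma cw_extend_second T (w0 w1 : T) g : cw_extend w0 w1 g cw_second = w1.
Proof. by rewrite /cw_extend /= liftK unlift_none. Qed.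

Lemma cw_extend_embed T (w0 w1 : T) g x : cw_extend w0 w1 g (cw_embed x) = g x.
Proof. by case: x => // i; rewrite /cw_extend /= !liftK. Qed.

End EmbedPair.

(** * Twisted generators in the larger algebra *)

Section Twist.
Variables (K : fieldType) (I : K) (A : algType K) (n k : nat).
Hypothesis I2 : I * I = -1.
Variable g : cw_index n.+2 k -> A.
Hypothesis gR : cw_relations g.
Hypothesis two_neq0 : (2 : K) != 0.

Let w0 := g (cw_first n k).
Let w1 := g (cw_second n k).
(* An involution anticommuting with [w0], [w1] and commuting with the other
   generators; multiplying the latter by it makes them commute with [w0], [w1]. *)
Definition cw_gamma : A := I *: (w0 * w1).
Let gamma := cw_gamma.

Lemma mul2r_inj (x y : A) : 2 * x = 2 * y -> x = y.
Proof.
move/(congr1 ( *:%R (2%:R^-1 : K))); rewrite !mulr_natl -!scaler_nat !scalerA.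
by rewrite mulVf // !scale1r.
Qed.

Lemma cw_square i : g (inl i) * g (inl i) = 1.
Proof.
have [ww _ _ _ _] := gR; apply: mul2r_inj.
by have := ww i i; rewrite eqxx mulr1 -mulr2n mulr_natl.
Qed.

Lemma cw_anticomm i j : i != j -> g (inl i) * g (inl j) = - (g (inl j) * g (inl i)).
Proof.
have [ww _ _ _ _] := gR => ij; apply/eqP; rewrite -addr_eq0; apply/eqP.
by have := ww i j; rewrite (negPf ij) mulr0.
Qed.

Lemma cw_embed_anticomm (i : 'I_n.+2) x : (i < 2)%N ->
  g (inl i) * g (cw_embed x) = - (g (cw_embed x) * g (inl i)).
Proof.
move=> i2; case: x => [j|y]; first by apply: cw_anticomm; rewrite -val_eqE neq_ltn (leq_trans i2).
have [_ _ _ _ wx] := gR; apply/eqP; rewrite -addr_eq0; exact/eqP/wx.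
Qed.

Lemma cw_first_square : w0 * w0 = 1. Proof. exact: cw_square. Qed.
Lemma cw_second_square : w1 * w1 = 1. Proof. exact: cw_square. Qed.
Lemma cw_second_first : w1 * w0 = - (w0 * w1). Proof. exact: cw_anticomm. Qed.

Lemma cw_gamma_first : gamma * w0 = - (w0 * gamma).
Proof.
by rewrite /gamma /cw_gamma -scalerAl -scalerAr -mulrA cw_second_first mulrN scalerN.
Qed.

Lemma cw_first_gamma : w0 * gamma = I *: w1.
Proof. by rewrite /gamma /cw_gamma -scalerAr mulrA cw_first_square mul1r. Qed.

Lemma cw_gamma_square : gamma * gamma = 1.
Proof.
rewrite {1}/gamma /cw_gamma -scalerAl -mulrA.
have -> : w1 * gamma = - (I *: w0).
  by rewrite /gamma /cw_gamma -scalerAr mulrA cw_second_first mulNr -mulrA cw_second_square mulr1 scalerN.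
by rewrite mulrN -scalerAr cw_first_square scalerN scalerA I2 scaleN1r opprK.
Qed.

Lemma cw_gamma_embed x : gamma * g (cw_embed x) = g (cw_embed x) * gamma.
Proof.
rewrite /gamma /cw_gamma -scalerAl -scalerAr; congr (_ *: _).
rewrite -mulrA [w1 * _](cw_embed_anticomm (i := lift ord0 ord0)) // mulrN mulrA.
by rewrite [w0 * g _](cw_embed_anticomm (i := ord0)) // mulNr opprK mulrA.
Qed.

Definition cw_twist (x : cw_index n k) : A := gamma * g (cw_embed x).

Lemma cw_twistM x y : cw_twist x * cw_twist y = g (cw_embed x) * g (cw_embed y).
Proof. by rewrite /cw_twist cw_gamma_embed -mulrA [gamma * (_ * _)]mulrA cw_gamma_square mul1r. Qed.

(** The generators enter each relation through products of two, in which the factors [gamma] cancel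
    by [cw_twistM]. *)
Lemma cw_twist_relations : cw_relations cw_twist.
Proof.
have [ww pq pp qq wx] := gR.
split=> [i j|i j|i j|i j|i y]; rewrite !cw_twistM /=; [|exact: pq|exact: pp|exact: qq|exact: wx].
by rewrite ww !(inj_eq lift_inj).
Qed.

Lemma cw_gamma_second : gamma * w1 = - (w1 * gamma).
Proof.
rewrite /gamma /cw_gamma -scalerAl -scalerAr [w1 * (_ * _)]mulrA cw_second_first mulNr.
by rewrite scalerN opprK.
Qed.

(** Both factors of [cw_twist x] anticommute with [w0], so the two signs cancel. *)
Lemma cw_twist_first x : cw_twist x * w0 = w0 * cw_twist x.
Proof.
have xw : g (cw_embed x) * w0 = - (w0 * g (cw_embed x)).
  by rewrite cw_embed_anticomm // opprK.
by rewrite /cw_twist -mulrA xw mulrN !mulrA cw_gamma_first mulNr opprK.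
Qed.

Lemma cw_twist_second x : cw_twist x * w1 = w1 * cw_twist x.
Proof.
have xw : g (cw_embed x) * w1 = - (w1 * g (cw_embed x)).
  by rewrite cw_embed_anticomm // opprK.
by rewrite /cw_twist -mulrA xw mulrN !mulrA cw_gamma_second mulNr opprK.
Qed.

End Twist.

(** * Matrix model over the smaller algebra *)

Section MatrixModel.
Variables (K : fieldType) (I : K) (D : algType K) (n k : nat).
Hypothesis I2 : I * I = -1.
Variable g : cw_index n k -> D.
Hypothesis gR : cw_relations g.

(** Up to sign, the first two generators go to off-diagonal Pauli matrices. The signs make
    [I *: (w0 * w1)] diagonal with entries 1 and -1, so that [e] becomes the matrix unit at [(0, 0)]
    and the twisted generators become scalar matrices. *)
Definition cw_mx2 : cw_index n.+2 k -> 'M[D]_2 :=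
  cw_extend (mx2 0 1 1 0) (mx2 0 I%:A (- I%:A) 0) (fun x => mx2 (g x) 0 0 (- g x)).

Lemma cw_mx2_embed x : cw_mx2 (cw_embed x) = mx2 (g x) 0 0 (- g x).
Proof. exact: cw_extend_embed. Qed.

Lemma cw_mx2_embedM x y : cw_mx2 (cw_embed x) * cw_mx2 (cw_embed y) =
  mx2 (g x * g y) 0 0 (g x * g y).
Proof. by rewrite !cw_mx2_embed mx2M !(mulr0, mul0r, addr0, add0r) mulrNN. Qed.

Let IA_central (a : D) : (I%:A : D) * a = a * I%:A.
Proof. by rewrite mulr_algl mulr_algr. Qed.

Let IAIA : (I%:A : D) * I%:A = -1.
Proof. by rewrite mulr_algl scalerA I2 scaleN1r. Qed.

Let mx2_first_embed x : cw_mx2 (cw_first n k) * cw_mx2 (cw_embed x) +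
  cw_mx2 (cw_embed x) * cw_mx2 (cw_first n k) = 0.
Proof.
rewrite /cw_mx2 cw_extend_first -/cw_mx2 cw_mx2_embed !mx2M mx2D.
rewrite !(mulr0, mul0r, addr0, add0r, mul1r, mulr1) addNr subrr.
exact: mx2_0.
Qed.

Let mx2_second_embed x : cw_mx2 (cw_second n k) * cw_mx2 (cw_embed x) +
  cw_mx2 (cw_embed x) * cw_mx2 (cw_second n k) = 0.
Proof.
rewrite /cw_mx2 cw_extend_second -/cw_mx2 cw_mx2_embed !mx2M mx2D.
rewrite !(mulr0, mul0r, addr0, add0r) mulrNN mulNr mulrN IA_central addNr.
exact: mx2_0.
Qed.

Lemma cw_mx2_relations : cw_relations cw_mx2.
Proof.
have [ww pq pp qq wx] := gR.
split=> [i j|i j|i j|i j|i y].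
- have Ee l : cw_mx2 (inl (lift ord0 (lift ord0 l))) = _ := cw_mx2_embed (inl l).
  have E0 : cw_mx2 (inl ord0) = mx2 0 1 1 0 := cw_extend_first _ _ _.
  have E1 : cw_mx2 (inl (lift ord0 ord0)) = _ := cw_extend_second _ _ _.
  have Fe := fun l => mx2_first_embed (inl l).
  have Se := fun l => mx2_second_embed (inl l).
  have FS : cw_mx2 (inl ord0) * cw_mx2 (inl (lift ord0 ord0)) +
            cw_mx2 (inl (lift ord0 ord0)) * cw_mx2 (inl ord0) = 0.
    rewrite E0 E1 !mx2M mx2D !(mulr0, mul0r, addr0, add0r, mul1r, mulr1).
    by rewrite addNr subrr mx2_0.
  have lift_neq p (l : 'I_p) : (lift ord0 l == ord0) = false by [].
  have neq_lift p (l : 'I_p) : (ord0 == lift ord0 l) = false by [].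
  case: (unliftP ord0 i) => [i1 ->|->]; last first.
    case: (unliftP ord0 j) => [j1 ->|->]; last first.
      rewrite eqxx mulr1 E0 mx2M mx2D !(mulr0, mul0r, addr0, add0r, mul1r).
      by rewrite mx2_nat.
    rewrite neq_lift mulr0; case: (unliftP ord0 j1) => [j2 ->|-> //].
    exact: Fe.
  case: (unliftP ord0 j) => [j1 ->|->]; last first.
    rewrite lift_neq mulr0 addrC; case: (unliftP ord0 i1) => [i2 ->|-> //].
    exact: Fe.
  rewrite (inj_eq lift_inj).
  case: (unliftP ord0 i1) => [i2 ->|->]; last first.
    case: (unliftP ord0 j1) => [j2 ->|->]; last first.
      rewrite eqxx mulr1 E1 mx2M mx2D !(mulr0, mul0r, addr0, add0r).
      by rewrite mulNr mulrN IAIA opprK mx2_nat.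
    by rewrite neq_lift mulr0; exact: Se.
  case: (unliftP ord0 j1) => [j2 ->|->]; last first.
    by rewrite lift_neq mulr0 addrC; exact: Se.
  rewrite (inj_eq lift_inj) !Ee !mx2M mx2D !(mulr0, mul0r, addr0, add0r) !mulrNN.
  by rewrite ww -natrM -mx2_nat natrM.
- have E := cw_mx2_embedM; rewrite (E (inr (inl i)) (inr (inr j))).
  by rewrite (E (inr (inr j)) (inr (inl i))) mx2N mx2D subr0 !pq mx2_nat.
- have E := cw_mx2_embedM; rewrite (E (inr (inl i)) (inr (inl j))) pp.
  by rewrite (E (inr (inl j)) (inr (inl i))).
- have E := cw_mx2_embedM; rewrite (E (inr (inr i)) (inr (inr j))) qq.
  by rewrite (E (inr (inr j)) (inr (inr i))).
(* [cw_indexP] ranges over all indices, so the claim is made trivial outside the Clifford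
   generators. *)
pose P x := if x is inl _ then
  cw_mx2 x * cw_mx2 (inr y) + cw_mx2 (inr y) * cw_mx2 x = 0 else True.
suff : P (inl i) by [].
apply: cw_indexP; rewrite /P; [exact: (mx2_first_embed (inr y))|exact: (mx2_second_embed (inr y))|].
case=> [l|//]; have E := cw_mx2_embedM.
have -> : cw_mx2 (cw_embed (inl l)) * cw_mx2 (inr y) = _ := E (inl l) (inr y).
have -> : cw_mx2 (inr y) * cw_mx2 (cw_embed (inl l)) = _ := E (inr y) (inl l).
by rewrite mx2D wx addr0 mx2_0.
Qed.

End MatrixModel.

(** * The full corner cut out by a pair of Clifford generators *)

Section CornerData.
Variables (K : fieldType) (I : K) (A D : algType K) (n k : nat).
Hypothesis I2 : I * I = -1.
Hypothesis two_neq0 : (2 : K) != 0.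
Variables (gA : cw_index n.+2 k -> A) (gD : cw_index n k -> D).
Hypothesis gAR : cw_relations gA.
Hypothesis indA : forall S : A -> Prop, S 1 ->
  (forall c a b, S a -> S b -> S (c *: a + b)) ->
  (forall x a, S a -> S (gA x * a)) -> forall a, S a.
Hypothesis indD : forall S : D -> Prop, S 1 ->
  (forall c a b, S a -> S b -> S (c *: a + b)) ->
  (forall x a, S a -> S (gD x * a)) -> forall a, S a.
Variable phi : D -> A.
Hypothesis phiD : forall a b, phi (a + b) = phi a + phi b.
Hypothesis phiM : forall a b, phi (a * b) = phi a * phi b.
Hypothesis phiZ : forall c a, phi (c *: a) = c *: phi a.
Hypothesis phi1 : phi 1 = 1.
Hypothesis phi_gen : forall x, phi (gD x) = cw_twist I gA x.
Variable psi : A -> 'M[D]_2.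
Hypothesis psiD : forall a b, psi (a + b) = psi a + psi b.
Hypothesis psiM : forall a b, psi (a * b) = psi a * psi b.
Hypothesis psiZ : forall c a, psi (c *: a) = (c%:A)%:M * psi a.
Hypothesis psi1 : psi 1 = 1.
Hypothesis psi_gen : forall x, psi (gA x) = cw_mx2 I gD x.

Let w0 := gA (cw_first n k).
Let w1 := gA (cw_second n k).
Let gamma := cw_gamma I gA.
Let e : A := (2%:R^-1 : K) *: (1 + gamma).
Let u (i : 'I_2) : A := if i == 0 then e else w0 * e.
Let v (i : 'I_2) : A := if i == 0 then e else e * w0.

Let w0w0 : w0 * w0 = 1. Proof. exact: (cw_first_square gAR two_neq0). Qed.
Let gw0 : gamma * w0 = - (w0 * gamma). Proof. exact: (cw_gamma_first I gAR). Qed.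
Let gg : gamma * gamma = 1. Proof. exact: (cw_gamma_square I2 gAR two_neq0). Qed.
Let w0g : w0 * gamma = I *: w1. Proof. exact: (cw_first_gamma I gAR two_neq0). Qed.

Let half2 (a : A) : (2%:R^-1 : K) *: (a + a) = a.
Proof. by rewrite -mulr2n -scaler_nat scalerA mulVf // scale1r. Qed.

Let ge : gamma * e = e.
Proof. by rewrite /e -scalerAr mulrDr mulr1 gg addrC. Qed.

Let eg : e * gamma = e.
Proof. by rewrite /e -scalerAl mulrDl mul1r gg addrC. Qed.

Let ee : e * e = e.
Proof. by rewrite {1}/e -scalerAl mulrDl mul1r ge half2. Qed.

Let w0e : w0 * e = w0 - e * w0.
Proof.
rewrite /e -scalerAl -scalerAr mulrDl mulrDr mul1r mulr1 gw0.
by apply/eqP; rewrite eq_sym subr_eq -scalerDr addrACA subrr addr0 half2.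
Qed.

Let ew0e : e * w0 * e = 0.
Proof. by rewrite -mulrA w0e mulrBr mulrA ee subrr. Qed.

(** Conjugation by [w0] reverses the sign of [gamma] and so exchanges [e] with [1 - e]; this is what
    makes [e] full in [uv1]. *)
Let w0ew0 : w0 * e * w0 = 1 - e.
Proof. by rewrite w0e mulrBl w0w0 -mulrA w0w0 mulr1. Qed.

Let I2P (P : 'I_2 -> Prop) : P 0 -> P 1 -> forall i, P i.
Proof.
move=> P0 P1 [[|[|//]] ri].
  by rewrite (_ : Ordinal ri = 0) //; exact/val_inj.
by rewrite (_ : Ordinal ri = 1) //; exact/val_inj.
Qed.

Let uv1 : \sum_i u i * v i = 1.
Proof.
rewrite !big_ord_recl big_ord0 addr0 /u /v /= ee mulrA -(mulrA w0 e e) ee w0ew0.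
by rewrite addrC subrK.
Qed.

Let phi_w0 d : phi d * w0 = w0 * phi d.
Proof.
elim/indD: d => [|c a b IHa IHb|x a IH]; first by rewrite phi1 mulr1 mul1r.
  by rewrite phiD phiZ mulrDl mulrDr -scalerAl -scalerAr IHa IHb.
rewrite phiM phi_gen -mulrA IH [LHS]mulrA [RHS]mulrA; congr (_ * _).
exact: (cw_twist_first I gAR).
Qed.

Let phi_w1 d : phi d * w1 = w1 * phi d.
Proof.
elim/indD: d => [|c a b IHa IHb|x a IH]; first by rewrite phi1 mulr1 mul1r.
  by rewrite phiD phiZ mulrDl mulrDr -scalerAl -scalerAr IHa IHb.
rewrite phiM phi_gen -mulrA IH [LHS]mulrA [RHS]mulrA; congr (_ * _).
exact: (cw_twist_second I gAR).
Qed.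

Let phi_gamma d : phi d * gamma = gamma * phi d.
Proof.
rewrite /gamma /cw_gamma -/w0 -/w1 -scalerAr -scalerAl; congr (_ *: _).
by rewrite mulrA phi_w0 -!mulrA phi_w1.
Qed.

Let phi_e d : phi d * e = e * phi d.
Proof. by rewrite /e -scalerAr -scalerAl mulrDr mulrDl phi_gamma mulr1 mul1r. Qed.

(** Multiplicative because [e] is an idempotent commuting with the image of [phi]; the unit goes to
    [e]. *)
Definition cw_iota (d : D) : A := phi d * e.
Definition cw_pr (a : A) : D := psi a 0 0.

Fact cw_iota_is_linear : linear cw_iota.
Proof. by move=> c a b; rewrite /cw_iota phiD phiZ mulrDl scalerAl. Qed.
HB.instance Definition _ := GRing.isLinear.Build K D A *:%R cw_iota cw_iota_is_linear.

Let psiZE c a i j : psi (c *: a) i j = c *: psi a i j.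
Proof. by rewrite psiZ scalar_mxME mulr_algl. Qed.

Fact cw_pr_is_linear : linear cw_pr.
Proof. by move=> c a b; rewrite /cw_pr psiD mxE psiZE. Qed.
HB.instance Definition _ := GRing.isLinear.Build K A D *:%R cw_pr cw_pr_is_linear.

Let iota1 : cw_iota 1 = e. Proof. by rewrite /cw_iota phi1 mul1r. Qed.

Let iotaM : {morph cw_iota : d d' / d * d'}.
Proof.
by move=> d d'; rewrite /cw_iota phiM -mulrA -[RHS]mulrA [e * _]mulrA -phi_e -mulrA ee.
Qed.

Let ev i : e * v i = v i.
Proof. by elim/I2P: i; rewrite /v /= ?mulrA ee. Qed.

Let ue i : u i * e = u i.
Proof. by elim/I2P: i; rewrite /u /= -?mulrA ee. Qed.

Let vu i j : v i * u j = (i == j)%:R * e.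
Proof.
elim/I2P: i; elim/I2P: j; rewrite /u /v /= ?mul0r ?mul1r ?ee //.
- by rewrite mulrA ew0e.
- by rewrite mulrA -(mulrA e w0 w0) w0w0 mulr1 ee.
Qed.

Let psi_gamma : psi gamma = mx2 1 0 0 (-1).
Proof.
rewrite /gamma /cw_gamma psiZ psiM !psi_gen /cw_mx2 cw_extend_first cw_extend_second.
rewrite scalar_mx2 !mx2M !(mulr0, mul0r, addr0, add0r, mul1r, mulr1).
by rewrite mulrN !mulr_algl scalerA I2 !scaleN1r opprK.
Qed.

Let psi_phi d : psi (phi d) = d%:M.
Proof.
elim/indD: d => [|c a b IHa IHb|x a IH]; first by rewrite phi1 psi1.
  by rewrite phiD phiZ psiD psiZ IHa IHb raddfD /= -[_ * _]scalar_mxM mulr_algl.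
rewrite phiM psiM IH phi_gen /cw_twist psiM psi_gamma psi_gen cw_mx2_embed.
rewrite scalar_mx2 !mx2M scalar_mx2 !(mulr0, mul0r, addr0, add0r, mul1r, mulr1).
by rewrite mulrNN mul1r.
Qed.

Let iotaK : cancel cw_iota cw_pr.
Proof.
move=> d; rewrite /cw_iota /cw_pr psiM psi_phi /e scalar_mxME psiZE.
rewrite psiD psi1 psi_gamma !mxE /= -mulr2n -scaler_nat scalerA mulVf //.
by rewrite scale1r mulr1.
Qed.

Let corner_gen x i j : v i * gA x * u j = cw_iota (cw_mx2 I gD x i j).
Proof.
have iota0 : cw_iota 0 = 0 by exact: linear0.
elim/cw_indexP: x => [||x].
- rewrite /cw_mx2 cw_extend_first -/w0; elim/I2P: i; elim/I2P: j; rewrite mxE /u /v /=.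
  + by rewrite ew0e iota0.
  + by rewrite iota1 mulrA -(mulrA e w0 w0) w0w0 mulr1 ee.
  + by rewrite iota1 -(mulrA e w0 w0) w0w0 mulr1 ee.
  + by rewrite iota0 -(mulrA e w0 w0) w0w0 mulr1 mulrA ew0e.
(* As [gamma * e = e], the relation [w0 * gamma = I *: w1] expresses [w1 * e] through [w0 * e]. *)
- have w1e : w1 * e = - (I *: (w0 * e)).
    by rewrite -[in RHS]ge mulrA w0g -scalerAl scalerA I2 scaleN1r opprK.
  have w1w0e : w1 * (w0 * e) = I *: e.
    rewrite mulrA (cw_second_first gAR) mulNr -mulrA w1e mulrN opprK -scalerAr mulrA.
    by rewrite -/w0 w0w0 mul1r.
  have iotaI c : cw_iota c%:A = c *: e by rewrite linearZ /= iota1.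
  rewrite /cw_mx2 cw_extend_second -/w1; elim/I2P: i; elim/I2P: j; rewrite mxE /u /v /=.
  + by rewrite -mulrA w1e mulrN -scalerAr mulrA ew0e scaler0 oppr0 iota0.
  + by rewrite -mulrA w1w0e -scalerAr ee iotaI.
  + rewrite -mulrA w1e mulrN -scalerAr mulrA -(mulrA e w0 w0) w0w0 mulr1 ee.
    by rewrite -scaleNr -iotaI scaleNr.
  + by rewrite -mulrA w1w0e -scalerAr ew0e scaler0 iota0.
(* Multiplication by [gamma] undoes the twist, since [gamma] squares to 1. *)
have gE : gA (cw_embed x) = gamma * phi (gD x).
  by rewrite phi_gen /cw_twist mulrA gg mul1r.
have ePe : e * phi (gD x) * e = cw_iota (gD x) by rewrite -phi_e -mulrA ee.
rewrite cw_mx2_embed gE; elim/I2P: i; elim/I2P: j; rewrite mxE /u /v /=.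
- by rewrite mulrA eg ePe.
- by rewrite (mulrA e gamma) eg -phi_e -[phi _ * e * _]mulrA [e * (_ * _)]mulrA ew0e mulr0 iota0.
- rewrite -mulrA -[gamma * _ * e]mulrA phi_e [gamma * _]mulrA ge mulrA ew0e mul0r.
  by rewrite iota0.
- rewrite -phi_gamma -!mulrA [gamma * (w0 * e)]mulrA gw0 mulNr -mulrA ge !mulrN.
  rewrite [phi _ * (w0 * e)]mulrA phi_w0 -mulrA [w0 * (w0 * _)]mulrA w0w0 mul1r.
  by rewrite phi_e mulrA ee -phi_e linearN.
Qed.

(** Both sides multiply like matrices in [a], the left one because [\sum_l u l * v l = 1] can be
    inserted between two factors. The generators were treated in [corner_gen]. *)
Let corner i j a : v i * a * u j = cw_iota (psi a i j).
Proof.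
elim/indA: a i j => [|c a b IHa IHb|x a IH] i j.
- by rewrite mulr1 vu psi1 mxE; case: (i == j); rewrite ?mul1r ?mul0r ?linear0 ?iota1.
- rewrite mulrDr mulrDl -scalerAr -scalerAl IHa IHb psiD mxE psiZE.
  by rewrite linearP.
rewrite psiM psi_gen mxE linear_sum /=.
transitivity (\sum_l (v i * gA x * u l) * (v l * a * u j)).
  have -> : v i * (gA x * a) * u j = v i * gA x * (\sum_l u l * v l) * a * u j.
    by rewrite uv1 mulr1 !mulrA.
  by rewrite mulr_sumr !mulr_suml; apply: eq_bigr => l _; rewrite !mulrA.
by apply: eq_bigr => l _; rewrite IH corner_gen -iotaM.
Qed.

Theorem pair_hoch_cohom l :
  exists phi : {linear hoch_cohom A l -> hoch_cohom D l}, bijective phi.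
Proof.
apply: (@corner_hoch_cohom K A D _ 0 u v cw_iota cw_pr) => //.
- by move=> a; rewrite /= iota1; have := corner 0 0 a; rewrite /u /v /= => ->.
- by rewrite /= iota1.
- by rewrite /= iota1.
- by move=> i j /negPf ij; rewrite vu ij mul0r.
Qed.

End CornerData.

(** * Conjugate elements in the Weyl algebra *)

Section WeylGenerators.
Variables (K : numFieldType) (A : algType K) (k : nat) (g : cw_index 0 k -> A).
Hypothesis gR : cw_relations g.
Hypothesis indA : forall S : A -> Prop, S 1 ->
  (forall c a b, S a -> S b -> S (c *: a + b)) ->
  (forall x a, S a -> S (g x * a)) -> forall a, S a.

Let p j := g (inr (inl j)).
Let q j := g (inr (inr j)).

Definition weyl_gen (i : 'I_(k + k)) : A :=
  match fintype.split i with inl j => p j | inr j => q j end.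

(** The commutator with [- q j] is the partial derivative along [p j], and the commutator with [p j]
    the one along [q j]. *)
Definition weyl_dual (i : 'I_(k + k)) : A :=
  match fintype.split i with inl j => - q j | inr j => p j end.

Let xl j : weyl_gen (lshift k j) = p j.
Proof. by rewrite /weyl_gen (unsplitK (inl j)). Qed.
Let xr j : weyl_gen (rshift k j) = q j.
Proof. by rewrite /weyl_gen (unsplitK (inr j)). Qed.
Let tl j : weyl_dual (lshift k j) = - q j.
Proof. by rewrite /weyl_dual (unsplitK (inl j)). Qed.
Let tr j : weyl_dual (rshift k j) = p j.
Proof. by rewrite /weyl_dual (unsplitK (inr j)). Qed.

Let pq i j : commutator (p i) (q j) = (i == j)%:R.
Proof. by have [_ pq _ _ _] := gR; exact: pq. Qed.
Let pp i j : commutator (p i) (p j) = 0.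
Proof. by have [_ _ pp _ _] := gR; rewrite /commutator /p pp subrr. Qed.
Let qq i j : commutator (q i) (q j) = 0.
Proof. by have [_ _ _ qq _] := gR; rewrite /commutator /q qq subrr. Qed.

Lemma commutatorNl (a b : A) : commutator (- a) b = commutator b a.
Proof. by rewrite /commutator mulNr mulrN opprK addrC. Qed.

Lemma commutatorNr (a b : A) : commutator a (- b) = commutator b a.
Proof. by rewrite /commutator mulNr mulrN opprK addrC. Qed.

Lemma weyl_dual_gen i j : commutator (weyl_dual j) (weyl_gen i) = (i == j)%:R.
Proof.
case: (split_ordP i) => i' ->; case: (split_ordP j) => j' ->.
- by rewrite tl xl commutatorNl pq eq_lshift.
- by rewrite tr xl pp eq_lrshift.
- by rewrite tl xr commutatorNl qq eq_rlshift.
- by rewrite tr xr pq eq_rshift eq_sym.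
Qed.

Lemma weyl_gen_gen i j : exists c, commutator (weyl_gen i) (weyl_gen j) = c%:A.
Proof.
case: (split_ordP i) => i' ->; case: (split_ordP j) => j' ->; rewrite ?xl ?xr.
- by exists 0; rewrite scale0r pp.
- by exists (i' == j')%:R; rewrite pq scaler_nat.
- by exists (- (j' == i')%:R); rewrite -[q i']opprK commutatorNl linearN /= pq scaleNr scaler_nat.
- by exists 0; rewrite scale0r qq.
Qed.

Theorem weyl_hoch_cohom0 l (z : hoch_cohom A l.+1) : z = 0.
Proof.
rewrite -[z]lmod_pi_repr -(linear0 (lmod_pi (@coboundary K A l.+1))).
apply/lmod_pi_eqP; rewrite subr0.
have gen (S : A -> Prop) : S 1 -> (forall c a b, S a -> S b -> S (c *: a + b)) ->
    (forall i a, S a -> S (weyl_gen i * a)) -> forall a, S a.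
  move=> S1 SD Sx; apply: indA => // -[[] //|[j|j]] a Sa.
    by rewrite -/(p j) -xl; exact: Sx.
  by rewrite -/(q j) -xr; exact: Sx.
(* With the opposite sign, the same conjugate elements are the variables of integration in degree
   0. *)
have xs j : commutator (weyl_gen j) (- weyl_dual j) = 1.
  by rewrite commutatorNr weyl_dual_gen eqxx.
have xs0 i j : i != j -> commutator (weyl_gen i) (- weyl_dual j) = 0.
  by move=> /negPf ij; rewrite commutatorNr weyl_dual_gen ij.
have [F mF FE] := @weyl_cocycle_coboundary K A (k + k) _ _ weyl_dual_gen weyl_gen_gen
  gen _ xs xs0 l _ (mlin_curry (repr z)) (cdiff_cocycle (repr z)).
exact: (coboundaryPS mF (esym FE)).
Qed.

End WeylGenerators.

(** * Presentation by generators and relations *)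

Section Presentation.
Variables (K : fieldType) (n k : nat).

(** The target [T] is a ring with a central image of [K]. This covers the 2 x 2 matrices over [D],
    where [c] acts as [(c%:A)%:M]. *)
Definition cw_presented (A : algType K) (g : cw_index n k -> A) : Prop :=
  [/\ cw_relations g,
      forall S : A -> Prop, S 1 ->
        (forall c a b, S a -> S b -> S (c *: a + b)) ->
        (forall x a, S a -> S (g x * a)) -> forall a, S a &
      forall (T : nzRingType) (s : {rmorphism K -> T}) (h : cw_index n k -> T),
        (forall c x, s c * x = x * s c) -> cw_relations h ->
        exists f : A -> T,
          [/\ forall a b, f (a + b) = f a + f b,
              forall a b, f (a * b) = f a * f b,
              forall c a, f (c *: a) = s c * f a,
              f 1 = 1 & forall x, f (g x) = h x]].

Lemma clifford_weyl_presented :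
  @cw_presented (clifford_weyl K n k) (@cw_gen K n k).
Proof.
split=> [||T s h sC hR]; [exact: cw_gen_relations|exact: cw_gen_ind|].
exists (cw_hom s h); split; [exact: cw_homD|exact: cw_homM|exact: cw_homZ| |].
  exact: cw_hom1.
exact: cw_hom_gen.
Qed.

End Presentation.

(** * Removing Clifford generators two at a time *)

Section CliffordWeylCohomology.
Variables (K : numClosedFieldType) (k : nat).

Let two_neq0 : (2 : K) != 0. Proof. by rewrite pnatr_eq0. Qed.
Let ii : 'i * 'i = -1 :> K. Proof. by rewrite -expr2 sqrCi. Qed.

(** The universal property of [D], applied to the twisted generators, gives [phi]; that of [A],
    applied to the matrix model, gives [psi]. *)
Lemma presented_pair n (A D : algType K) (gA : cw_index n.+2 k -> A)
    (gD : cw_index n k -> D) l : cw_presented gA -> cw_presented gD ->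
  exists phi : {linear hoch_cohom A l -> hoch_cohom D l}, bijective phi.
Proof.
move=> [rA indA homA] [rD indD homD].
have [phi [phiD phiM phiZ phi1 phi_gen]] : exists f : D -> A,
    [/\ forall a b, f (a + b) = f a + f b, forall a b, f (a * b) = f a * f b,
        forall c a, f (c *: a) = c%:A * f a, f 1 = 1 &
        forall x, f (gD x) = cw_twist 'i gA x].
  apply: (homD A (in_alg A)) => [c x|]; first by rewrite /= mulr_algl mulr_algr.
  exact: cw_twist_relations.
have [psi [psiD psiM psiZ psi1 psi_gen]] : exists f : A -> 'M[D]_2,
    [/\ forall a b, f (a + b) = f a + f b, forall a b, f (a * b) = f a * f b,
        forall c a, f (c *: a) = (c%:A)%:M * f a, f 1 = 1 &
        forall x, f (gA x) = cw_mx2 'i gD x].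
  apply: (homA _ (scalar_mx \o in_alg D)) => [c x|]; last exact: cw_mx2_relations.
  by apply: scalar_mx_central => b; rewrite mulr_algl mulr_algr.
have phiZ' c a : phi (c *: a) = c *: phi a by rewrite phiZ mulr_algl.
exact: (@pair_hoch_cohom K 'i A D n k ii two_neq0 _ _ rA indA indD
  _ phiD phiM phiZ' phi1 phi_gen _ psiD psiM psiZ psi1 psi_gen).
Qed.

Lemma clifford_weyl_pair n l :
  exists phi : {linear hoch_cohom (clifford_weyl K n.+2 k) l ->
                       hoch_cohom (clifford_weyl K n k) l}, bijective phi.
Proof. exact: presented_pair (clifford_weyl_presented K _ k) (clifford_weyl_presented K n k). Qed.

Lemma weyl_cohom0 l (z : hoch_cohom (clifford_weyl K 0 k) l.+1) : z = 0.
Proof. exact: (weyl_hoch_cohom0 (@cw_gen_relations K 0 k) (@cw_gen_ind K 0 k)). Qed.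

Lemma clifford_weyl_even_cohom0 n l (z : hoch_cohom (clifford_weyl K (2 * n) k) l.+1) :
  z = 0.
Proof.
elim: n z => [|n IH] z; first exact: weyl_cohom0.
move: z; rewrite mulnS => z; have [phi [psi phiK _]] := clifford_weyl_pair (2 * n) l.+1.
by rewrite -(phiK z) -(phiK 0) (IH (phi z)) linear0.
Qed.

Lemma clifford_weyl_odd n l :
  exists phi : {linear hoch_cohom (clifford_weyl K (2 * n).+1 k) l ->
                       hoch_cohom (clifford_weyl K 1 k) l}, bijective phi.
Proof.
elim: n => [|n [psi bpsi]]; first by exists idfun; exact: (Bijective (g := idfun)).
rewrite mulnS; have [phi bphi] := clifford_weyl_pair (2 * n).+1 l.
by exists (psi \o phi); exact: bij_comp.
Qed.

End CliffordWeylCohomology.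

Theorem theorem3 (R : realType) (n k : nat) :
  (forall l : nat, (0 < l)%N ->
     forall x : hoch_cohom (clifford_weyl R[i] (2 * n) k) l, x = 0) /\
  (forall l : nat,
     exists phi : {linear hoch_cohom (clifford_weyl R[i] (2 * n).+1 k) l ->
                          hoch_cohom (clifford_weyl R[i] 1 k) l},
       bijective phi).
Proof.
split=> [[//|l] _ x|l]; first exact: clifford_weyl_even_cohom0.
exact: clifford_weyl_odd.
Qed.
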